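(* Let $n\geq 3$, and let $G$ be any one of the groups $\mathrm{Aut}(F_n)$, $\mathrm{SAut}(F_n)$, $\mathrm{Out}(F_n)$, $\mathrm{SOut}(F_n)$, $GL(n,\mathbb{Z})$, $SL(n,\mathbb{Z})$. Let $H$ be a non-cyclic quotient of $G$, with quotient map (surjective homomorphism) $q: G\to H$. Then either $|H|>|SL(n,\mathbb{Z}_2)|$, or $H$ is isomorphic to $SL(n,\mathbb{Z}_2)$. Moreover, in the latter case, the quotient map $q$ is obtained by postcomposing the natural map $\pi: G\to SL(n,\mathbb{Z}_2)$ with an automorphism of $SL(n,\mathbb{Z}_2)$ (after identifying $H$ with $SL(n,\mathbb{Z}_2)$; equivalently, $q=\theta\circ\pi$ for some isomorphism $\theta: SL(n,\mathbb{Z}_2)\to H$).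
   Context: $F_n$ is the free group of rank $n$, and $\mathbb{Z}_2=\mathbb{Z}/2\mathbb{Z}$. $\mathrm{Aut}(F_n)$ is its automorphism group, and $\mathrm{Out}(F_n)$ is the quotient of $\mathrm{Aut}(F_n)$ by inner automorphisms. Every automorphism of $F_n$ induces an automorphism of the abelianization $\mathbb{Z}^n$, giving a homomorphism $\mathrm{Aut}(F_n)\to GL(n,\mathbb{Z})$, which factors through $\mathrm{Out}(F_n)$. $\mathrm{SAut}(F_n)$ (special automorphisms) is the subgroup of $\mathrm{Aut}(F_n)$ of elements whose image in $GL(n,\mathbb{Z})$ has determinant $1$, and $\mathrm{SOut}(F_n)$ is its image in $\mathrm{Out}(F_n)$. The natural map $\pi: G\to SL(n,\mathbb{Z}_2)=GL(n,\mathbb{Z}_2)$ is the map from $G$ to $GL(n,\mathbb{Z})$ (the induced action on $\mathbb{Z}^n$ if $G$ is one of the four groups of (outer) automorphisms of $F_n$, the inclusion if $G$ is $GL(n,\mathbb{Z})$ or $SL(n,\mathbb{Z})$) followed by reduction modulo $2$. A quotient of $G$ is the target of a surjective group homomorphism from $G$; it may be infinite, in which case $|H|>|SL(n,\mathbb{Z}_2)|$ holds. *)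

(* Defs.v *)
From HB Require Import structures.
From mathcomp Require Import all_boot all_order all_algebra.
From mathcomp Require Import boolp classical_sets functions cardinality.

Set Implicit Arguments.
Unset Strict Implicit.
Unset Printing Implicit Defensive.

Import GRing.Theory.

Local Open Scope group_scope.

Lemma morph_divg (G H : groupType) (f : G -> H) :
  {morph f : x y / x * y} -> {morph f : x y / x / y}.
Proof.
by move=> fM x y; apply: (@mulIg _ (f y)); rewrite mulgVK -fM mulgVK.
Qed.

Section FreeGroup.
Variable n : nat.

(* The letter (i, false) is x_i and (i, true) is its formal inverse. *)
Definition letter : Type := ('I_n * bool)%type.

Definition linv (a : letter) : letter := (a.1, ~~ a.2).

Definition reduced (w : seq letter) : bool :=
  sorted (fun a b => b != linv a) w.

Definition red_cons (a : letter) (w : seq letter) : seq letter :=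
  if w is b :: w' then if b == linv a then w' else a :: w else [:: a].

(* The reduced form of the concatenation u ++ v, for v reduced. *)
Definition red_cat (u v : seq letter) : seq letter := foldr red_cons v u.

Lemma linvK : involutive linv.
Proof. by case=> i b; rewrite /linv /= negbK. Qed.

Lemma red_cons_reduced a w : reduced w -> reduced (red_cons a w).
Proof.
case: w => [|b w] //= rw; case: eqP => [_|/eqP nb]; first exact: path_sorted rw.
by rewrite /= nb.
Qed.

Lemma red_cat_reduced u v : reduced v -> reduced (red_cat u v).
Proof. by move=> rv; elim: u => //= a u; apply: red_cons_reduced. Qed.

Lemma red_consK a w :
  reduced w -> red_cons a (red_cons (linv a) w) = w.
Proof.
case: w => [|b w] /=; first by rewrite eqxx.
rewrite linvK; have [-> |nb] := eqVneq b a; last by rewrite /= eqxx.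
by case: w => //= c w /andP[/negPf->].
Qed.

Lemma red_cat_rcons a u v : reduced u -> reduced v ->
  red_cat (red_cons a u) v = red_cons a (red_cat u v).
Proof.
case: u => //= b u; have [->|//] := eqVneq b (linv a).
by move=> /path_sorted ru rv; rewrite red_consK // red_cat_reduced.
Qed.

Lemma red_cats0 u : reduced u -> red_cat u [::] = u.
Proof.
elim: u => //= a u IHu /[dup] /path_sorted ru; rewrite IHu //.
by case: u {IHu ru} => //= b u /andP[/negPf->].
Qed.

Lemma red_catA u v w : reduced v -> reduced w ->
  red_cat u (red_cat v w) = red_cat (red_cat u v) w.
Proof.
move=> rv rw; elim: u => //= a u ->.
by rewrite red_cat_rcons // red_cat_reduced.
Qed.

Record free_group : Type := FreeGroup {
  fg_word :> seq letter;
  fg_wordP : reduced fg_word }.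

HB.instance Definition _ := [isSub for fg_word].
HB.instance Definition _ := [Choice of free_group by <:].

Definition fg_one : free_group := @FreeGroup [::] isT.

Definition fg_mul (u v : free_group) : free_group :=
  FreeGroup (red_cat_reduced u (fg_wordP v)).

Lemma fg_inv_reduced (u : free_group) : reduced (rev (map linv u)).
Proof.
case: u => u /= ru; rewrite /reduced rev_sorted sorted_map.
apply: sub_sorted ru => a b /=; rewrite linvK.
by apply: contraNneq => ->.
Qed.

Definition fg_inv (u : free_group) : free_group := FreeGroup (fg_inv_reduced u).

Fact fg_mulA : associative fg_mul.
Proof. by move=> u v w; apply/val_inj; rewrite /= red_catA ?fg_wordP. Qed.

Fact fg_mul1 : left_id fg_one fg_mul.
Proof. by move=> u; apply/val_inj. Qed.

Fact fg_mulr1 : right_id fg_one fg_mul.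
Proof. by move=> u; apply/val_inj; rewrite /= red_cats0 ?fg_wordP. Qed.

Fact fg_mulVg : left_inverse fg_one fg_inv fg_mul.
Proof.
case=> u ru; apply/val_inj => /=; rewrite -[RHS]/[::].
elim: u ru => //= a u IHu rau; have ru := path_sorted rau.
by rewrite rev_cons /red_cat foldr_rcons /= linvK eqxx; apply: IHu.
Qed.

Fact fg_mulgV : right_inverse fg_one fg_inv fg_mul.
Proof.
move=> u; have := fg_mulVg (fg_inv u); congr (fg_mul _ _ = _).
by apply/val_inj; rewrite /= map_rev revK mapK //; apply: linvK.
Qed.

HB.instance Definition _ := isGroup.Build free_group
  fg_mulA fg_mul1 fg_mulr1 fg_mulVg fg_mulgV.

Definition fg_gen (i : 'I_n) : free_group := @FreeGroup [:: (i, false)] isT.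

Lemma fg_cons a u (rau : reduced (a :: u)) (ru : reduced u) :
  FreeGroup rau =
    (if a.2 then (fg_gen a.1)^-1 else fg_gen a.1) * FreeGroup ru.
Proof.
apply/val_inj => /=; rewrite -(red_cats0 rau) /= (red_cats0 ru).
by case: a {rau} => i [].
Qed.

Lemma fg_ind (P : free_group -> Prop) :
  P 1 -> (forall i u, P u -> P (fg_gen i * u)) ->
  (forall i u, P u -> P ((fg_gen i)^-1 * u)) -> forall u, P u.
Proof.
move=> P1 PM PV [u ru]; elim: u ru => [|a u IHu] rau.
  by rewrite (_ : FreeGroup rau = 1) //; apply/val_inj.
have ru : reduced u := path_sorted rau.
by rewrite (fg_cons rau ru); case: a.2; [apply: PV | apply: PM].
Qed.

Section UniversalProperty.
Variables (G : groupType) (f : 'I_n -> G).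

Definition letter_val (a : letter) : G := if a.2 then (f a.1)^-1 else f a.1.

Definition fg_lift (u : free_group) : G := \prod_(a <- u) letter_val a.

Fact fg_lift_mul : {morph fg_lift : u v / u * v}.
Proof.
have step a w : \prod_(b <- red_cons a w) letter_val b
              = letter_val a * \prod_(b <- w) letter_val b.
  case: w => [|b w] /=; first by rewrite big_cons.
  have [->|_] := eqVneq b (linv a); last by rewrite big_cons.
  rewrite big_cons mulgA; case: a => i [];
    by rewrite /letter_val /= ?mulVg ?mulgV mul1g.
move=> u v; rewrite /fg_lift /=; elim: (fg_word u) => [|a w IHw] /=.
  by rewrite big_nil mul1g.
by rewrite step IHw big_cons mulgA.
Qed.

HB.instance Definition _ :=
  isGroupMorphism.Build free_group G fg_lift
    (morph_divg fg_lift_mul).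

Lemma fg_lift_gen i : fg_lift (fg_gen i) = f i.
Proof. by rewrite /fg_lift /= big_seq1. Qed.

End UniversalProperty.

Lemma fg_hom_ext (G : groupType) 
    (f g : UMagmaMorphism.type free_group G) :
  (forall i, f (fg_gen i) = g (fg_gen i)) -> f =1 g.
Proof.
move=> fg; apply: fg_ind => [|i u IHu|i u IHu]; rewrite ?gmulf1 //.
  by rewrite !gmulfM fg IHu.
by rewrite !gmulfM !gmulfV fg IHu.
Qed.

End FreeGroup.

Section Automorphisms.
Variable G : groupType.

Definition is_aut (f : G -> G) : bool :=
  `[< bijective f /\ {morph f : x y / x * y} >].

Record autg : Type := Autg { autg_fun :> G -> G; autgP : is_aut autg_fun }.

HB.instance Definition _ := [isSub for autg_fun].
HB.instance Definition _ := [Choice of autg by <:].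

Lemma autgM (f : autg) : {morph f : x y / x * y}.
Proof. by case: f => f /= /asboolP[]. Qed.

HB.instance Definition _ (f : autg) :=
  isGroupMorphism.Build G G (autg_fun f)
    (morph_divg (@autgM f)).

Lemma autg_bij (f : autg) : bijective f.
Proof. by case: f => f /= /asboolP[]. Qed.

Lemma autg_inj (f : autg) : injective f.
Proof. exact/bij_inj/autg_bij. Qed.

Fact autg_one_subproof : is_aut (@id G).
Proof. by apply/asboolP; split=> //; exists id. Qed.

Fact autg_mul_subproof (f g : autg) : is_aut (f \o g).
Proof.
apply/asboolP; split; first exact: bij_comp (autg_bij f) (autg_bij g).
by move=> x y /=; rewrite !autgM.
Qed.

Fact autg_inv_exists (f : autg) : exists g : G -> G, cancel g f.
Proof. by case: (autg_bij f) => g _ fK; exists g. Qed.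

Definition autg_inv_fun (f : autg) : G -> G := projT1 (cid (autg_inv_exists f)).

Lemma autg_inv_funK f : cancel (autg_inv_fun f) f.
Proof. exact: projT2 (cid (autg_inv_exists f)). Qed.

Fact autg_inv_subproof (f : autg) : is_aut (autg_inv_fun f).
Proof.
have invK := autg_inv_funK f.
have Kinv : cancel f (autg_inv_fun f) := inj_can_sym invK (@autg_inj f).
apply/asboolP; split; first by exists f.
by move=> x y; apply: (@autg_inj f); rewrite autgM !invK.
Qed.

Definition autg_one := Autg autg_one_subproof.
Definition autg_mul f g := Autg (autg_mul_subproof f g).
Definition autg_inv f := Autg (autg_inv_subproof f).

Fact autg_mulA : associative autg_mul.
Proof. by move=> f g h; apply/val_inj. Qed.

Fact autg_mul1 : left_id autg_one autg_mul.
Proof. by move=> f; apply/val_inj. Qed.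

Fact autg_mulr1 : right_id autg_one autg_mul.
Proof. by move=> f; apply/val_inj. Qed.

Fact autg_mulgV : right_inverse autg_one autg_inv autg_mul.
Proof.
by move=> f; apply/val_inj; apply: funext => x /=; rewrite autg_inv_funK.
Qed.

Fact autg_mulVg : left_inverse autg_one autg_inv autg_mul.
Proof.
move=> f; apply/val_inj; apply: funext => x /=.
by apply: (@autg_inj f); rewrite autg_inv_funK.
Qed.

HB.instance Definition _ := isGroup.Build autg
  autg_mulA autg_mul1 autg_mulr1 autg_mulVg autg_mulgV.

Lemma autg_ext (f g : autg) : f =1 g -> f = g.
Proof. by move=> fg; apply/val_inj/funext. Qed.

Fact inner_subproof (a : G) : is_aut (fun x => a * x * a^-1).
Proof.
apply/asboolP; split; last by move=> x y; rewrite !mulgA mulgVK.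
exists (fun x => a^-1 * x * a) => x; first by rewrite !mulgA mulVg mul1g mulgVK.
by rewrite !mulgA mulgV mul1g mulgK.
Qed.

Definition inner (a : G) : autg := Autg (inner_subproof a).

Lemma inner1 : inner 1 = 1.
Proof. by apply: autg_ext => x /=; rewrite invg1 mulg1 mul1g. Qed.

Lemma innerM : {morph inner : a b / a * b}.
Proof. by move=> a b; apply: autg_ext => x /=; rewrite invgM !mulgA. Qed.

HB.instance Definition _ := isGroupMorphism.Build G autg inner
    (morph_divg innerM).

Lemma mulg_inner (f : autg) a : f * inner a = inner (f a) * f.
Proof. by apply: autg_ext => x /=; rewrite !autgM gmulfV. Qed.

Definition eq_out (f g : autg) : bool := `[< exists a, f = inner a * g >].

Fact eq_out_refl : reflexive eq_out.
Proof. by move=> f; apply/asboolP; exists 1; rewrite inner1 mul1g. Qed.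

Fact eq_out_sym : symmetric eq_out.
Proof.
suff imp f g : eq_out f g -> eq_out g f by move=> f g; apply/idP/idP; apply: imp.
by case/asboolP=> a ->; apply/asboolP; exists a^-1; rewrite gmulfV mulKg.
Qed.

Fact eq_out_trans : transitive eq_out.
Proof.
move=> g f h /asboolP[a ->] /asboolP[b ->]; apply/asboolP.
by exists (a * b); rewrite gmulfM mulgA.
Qed.

Canonical eq_out_equiv := EquivRel eq_out eq_out_refl eq_out_sym eq_out_trans.

Definition outg : Type := {eq_quot eq_out_equiv}%qT.

HB.instance Definition _ := Choice.on outg.
HB.instance Definition _ := EqQuotient.on outg.

Definition to_outg (f : autg) : outg := \pi_outg%qT f.

Lemma to_outgP f g : to_outg f = to_outg g <-> exists a, f = inner a * g.
Proof.
split=> [/eqP|[a ->]]; first by rewrite /to_outg eqmodE => /asboolP.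
by apply/eqP; rewrite /to_outg eqmodE; apply/asboolP; exists a.
Qed.

Lemma to_outg_repr (o : outg) : to_outg (repr o) = o.
Proof. exact: reprK. Qed.

Definition outg_one : outg := to_outg 1.
Definition outg_mul (o p : outg) : outg := to_outg (repr o * repr p).
Definition outg_inv (o : outg) : outg := to_outg (repr o)^-1.

Lemma outg_mulE f g : outg_mul (to_outg f) (to_outg g) = to_outg (f * g).
Proof.
have /to_outgP[a ef] := to_outg_repr (to_outg f).
have /to_outgP[b eg] := to_outg_repr (to_outg g).
apply/to_outgP; exists (a * f b).
by rewrite ef eg gmulfM !mulgA -!(mulgA (inner a)) mulg_inner.
Qed.

Fact outg_mulA : associative outg_mul.
Proof.
move=> o p q; rewrite -(to_outg_repr o) -(to_outg_repr p) -(to_outg_repr q).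
by rewrite !outg_mulE mulgA.
Qed.

Fact outg_mul1 : left_id outg_one outg_mul.
Proof. by move=> o; rewrite -(to_outg_repr o) outg_mulE mul1g. Qed.

Fact outg_mulr1 : right_id outg_one outg_mul.
Proof. by move=> o; rewrite -(to_outg_repr o) outg_mulE mulg1. Qed.

Fact outg_mulVg : left_inverse outg_one outg_inv outg_mul.
Proof.
by move=> o; rewrite -{2}(to_outg_repr o) outg_mulE mulVg.
Qed.

Fact outg_mulgV : right_inverse outg_one outg_inv outg_mul.
Proof.
by move=> o; rewrite -{1}(to_outg_repr o) outg_mulE mulgV.
Qed.

HB.instance Definition _ := isGroup.Build outg
  outg_mulA outg_mul1 outg_mulr1 outg_mulVg outg_mulgV.

Lemma to_outgM : {morph to_outg : f g / f * g}.
Proof. by move=> f g; rewrite -outg_mulE. Qed.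

HB.instance Definition _ := isGroupMorphism.Build autg outg to_outg
    (morph_divg to_outgM).

End Automorphisms.

Section LinearGroups.
Variables (n : nat) (R : comUnitRingType).

(* Unlike {'GL_n[R]}, which requires R finite and n > 0. *)
Record GL : Type := MkGL { GL_mx :> 'M[R]_n; GL_mxP : GL_mx \in unitmx }.

HB.instance Definition _ := [isSub for GL_mx].
HB.instance Definition _ := [Choice of GL by <:].

Fact GL_one_subproof : (1%:M : 'M[R]_n)%R \in unitmx.
Proof. exact: unitmx1. Qed.

Fact GL_mul_subproof (A B : GL) : (A *m B)%R \in unitmx.
Proof. by rewrite unitmx_mul !GL_mxP. Qed.

Fact GL_inv_subproof (A : GL) : invmx A \in unitmx.
Proof. by rewrite unitmx_inv GL_mxP. Qed.

Definition GL_one := MkGL GL_one_subproof.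
Definition GL_mul A B := MkGL (GL_mul_subproof A B).
Definition GL_inv A := MkGL (GL_inv_subproof A).

Fact GL_mulA : associative GL_mul.
Proof. by move=> A B C; apply/val_inj; rewrite /= mulmxA. Qed.

Fact GL_mul1 : left_id GL_one GL_mul.
Proof. by move=> A; apply/val_inj; rewrite /= mul1mx. Qed.

Fact GL_mulr1 : right_id GL_one GL_mul.
Proof. by move=> A; apply/val_inj; rewrite /= mulmx1. Qed.

Fact GL_mulVg : left_inverse GL_one GL_inv GL_mul.
Proof. by move=> A; apply/val_inj; rewrite /= mulVmx ?GL_mxP. Qed.

Fact GL_mulgV : right_inverse GL_one GL_inv GL_mul.
Proof. by move=> A; apply/val_inj; rewrite /= mulmxV ?GL_mxP. Qed.

HB.instance Definition _ := isGroup.Build GL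
  GL_mulA GL_mul1 GL_mulr1 GL_mulVg GL_mulgV.

Definition SL_pred : pred GL := fun A => (\det A == 1)%R.

Fact SL_closed : group_closed SL_pred.
Proof.
split=> [|A B]; rewrite ?unfold_in /SL_pred /= ?det1 // det_mulmx det_inv.
by move=> /eqP-> /eqP->; rewrite invr1 mulr1.
Qed.

Record SL : Type := MkSL { SL_GL :> GL; SL_GLP : SL_pred SL_GL }.

HB.instance Definition _ := [isSub for SL_GL].
HB.instance Definition _ := [Choice of SL by <:].
HB.instance Definition _ := SubChoice_isSubGroup.Build GL SL_pred SL SL_closed.

End LinearGroups.

Section Reduction.
Variables (n : nat) (R S : comUnitRingType) (f : {rmorphism R -> S}).

Fact GL_map_subproof (A : GL n R) : map_mx f A \in unitmx.
Proof. by rewrite unitmxE det_map_mx rmorph_unit // -unitmxE GL_mxP. Qed.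

Definition GL_map (A : GL n R) : GL n S := MkGL (GL_map_subproof A).

Fact GL_mapM : {morph GL_map : A B / A * B}.
Proof. by move=> A B; apply/val_inj; rewrite /= map_mxM. Qed.

HB.instance Definition _ :=
  isGroupMorphism.Build (GL n R) (GL n S) GL_map
    (morph_divg GL_mapM).

End Reduction.

Section ModTwo.
Variable n : nat.

Fact GL_F2_det (A : GL n 'F_2) : SL_pred A.
Proof.
have := GL_mxP A; rewrite unitmxE unitfE /SL_pred.
by case: (\det A)%R => -[|[|]].
Qed.

(* The equality GL(n, Z/2) = SL(n, Z/2). *)
Definition GL_SL_F2 (A : GL n 'F_2) : SL n 'F_2 := MkSL (GL_F2_det A).

Definition mod2 (A : GL n int) : SL n 'F_2 :=
  GL_SL_F2 (GL_map (intmul 1%R : {rmorphism int -> 'F_2}) A).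

Fact mod2M : {morph mod2 : A B / A * B}.
Proof. by move=> A B; apply/val_inj; rewrite /= gmulfM. Qed.

HB.instance Definition _ :=
  isGroupMorphism.Build (GL n int) (SL n 'F_2) mod2
    (morph_divg mod2M).

End ModTwo.

Section Abelianization.
Variable n : nat.
Local Notation F := (free_group n).

Definition letter_ab (a : letter n) : 'cV[int]_n :=
  ((-1) ^+ a.2 *: delta_mx a.1 ord0)%R.

(* The abelianization map F_n -> Z^n, by exponent sums. *)
Definition fg_ab (u : F) : 'cV[int]_n := (\sum_(a <- u) letter_ab a)%R.

Lemma fg_ab1 : fg_ab 1 = 0%R.
Proof. by rewrite /fg_ab big_nil. Qed.

Lemma fg_abM u v : fg_ab (u * v) = (fg_ab u + fg_ab v)%R.
Proof.
have step a w : (\sum_(b <- red_cons a w) letter_ab b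
                 = letter_ab a + \sum_(b <- w) letter_ab b)%R.
  case: w => [|b w] /=; first by rewrite big_cons.
  have [->|_] := eqVneq b (linv a); last by rewrite big_cons.
  rewrite big_cons addrA; case: a => i [];
    by rewrite /letter_ab /= ?expr1 ?expr0 ?scaleN1r ?scale1r ?addNr ?subrr add0r.
rewrite /fg_ab /=; elim: (fg_word u) => [|a w IHw] /=.
  by rewrite big_nil add0r.
by rewrite step IHw big_cons addrA.
Qed.

Lemma fg_abV u : fg_ab u^-1 = (- fg_ab u)%R.
Proof. by apply/eqP; rewrite -addr_eq0 -fg_abM mulVg fg_ab1. Qed.

Lemma fg_ab_gen i : fg_ab (fg_gen i) = delta_mx i ord0.
Proof. by rewrite /fg_ab /= big_seq1 /letter_ab expr0 scale1r. Qed.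

(* The j-th column is the image in Z^n of f(x_j), so that composition of
   automorphisms corresponds to the matrix product. *)
Definition aut_mx (f : autg F) : 'M[int]_n :=
  (\matrix_(i, j) fg_ab (f (fg_gen j)) i ord0)%R.

Lemma aut_mxP (f : autg F) u : fg_ab (f u) = (aut_mx f *m fg_ab u)%R.
Proof.
have gen i : fg_ab (f (fg_gen i)) = (aut_mx f *m delta_mx i ord0)%R.
  rewrite -colE; apply/matrixP => k l.
  by rewrite !mxE [l]ord1.
elim/fg_ind: u => [|i u IHu|i u IHu].
- by rewrite gmulf1 fg_ab1 mulmx0.
- by rewrite gmulfM !fg_abM IHu gen fg_ab_gen mulmxDr.
by rewrite gmulfM gmulfV !fg_abM !fg_abV IHu gen fg_ab_gen mulmxDr mulmxN.
Qed.

Lemma aut_mx1 : aut_mx 1 = 1%:M%R.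
Proof.
apply/matrixP => i j; rewrite mxE -[(1 : autg F) _]/(fg_gen j) fg_ab_gen !mxE.
by rewrite eqxx andbT.
Qed.

Lemma aut_mxM f g : aut_mx (f * g) = (aut_mx f *m aut_mx g)%R.
Proof.
apply/matrixP => i j; rewrite mxE -[(f * g) _]/(f (g _)) aut_mxP !mxE.
by apply: eq_bigr => k _; rewrite !mxE.
Qed.

Fact aut_GL_subproof f : aut_mx f \in unitmx.
Proof.
have /mulmx1_unit[] // : (aut_mx f *m aut_mx (f^-1)%g = 1%:M)%R.
by rewrite -aut_mxM mulgV aut_mx1.
Qed.

Definition aut_GL (f : autg F) : GL n int := MkGL (aut_GL_subproof f).

Fact aut_GLM : {morph aut_GL : f g / f * g}.
Proof. by move=> f g; apply/val_inj; rewrite /= aut_mxM. Qed.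

HB.instance Definition _ :=
  isGroupMorphism.Build (autg F) (GL n int) aut_GL
    (morph_divg aut_GLM).

Lemma aut_GL_inner a : aut_GL (inner a) = 1.
Proof.
apply/val_inj/matrixP => i j; rewrite /= mxE /= !fg_abM fg_abV fg_ab_gen.
by rewrite addrC addKr !mxE eqxx andbT.
Qed.

(* aut_GL factors through Out(F_n), see out_GLE. *)
Definition out_GL (o : outg F) : GL n int := aut_GL (repr o).

Lemma out_GLE f : out_GL (to_outg f) = aut_GL f.
Proof.
have /to_outgP[a] := to_outg_repr (to_outg f).
by rewrite /out_GL => ->; rewrite aut_GLM aut_GL_inner mul1g.
Qed.

Fact out_GLM : {morph out_GL : f g / f * g}.
Proof.
move=> o p; rewrite -(to_outg_repr o) -(to_outg_repr p) -to_outgM.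
by rewrite !out_GLE gmulfM.
Qed.

HB.instance Definition _ :=
  isGroupMorphism.Build (outg F) (GL n int) out_GL
    (morph_divg out_GLM).

Definition SAut_pred : pred (autg F) := fun f => SL_pred (aut_GL f).

Fact SAut_closed : group_closed SAut_pred.
Proof.
have [cl1 clF] := SL_closed n int.
split=> [|f g]; rewrite ?unfold_in /SAut_pred ?gmulf1 //.
by rewrite gmulfF; apply: clF.
Qed.

Record SAut : Type := MkSAut { SAut_aut :> autg F; SAutP : SAut_pred SAut_aut }.

HB.instance Definition _ := [isSub for SAut_aut].
HB.instance Definition _ := [Choice of SAut by <:].
HB.instance Definition _ :=
  SubChoice_isSubGroup.Build (autg F) SAut_pred SAut SAut_closed.

Definition SOut_pred : pred (outg F) :=
  fun o => `[< exists2 f, SAut_pred f & to_outg f = o >].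

Fact SOut_closed : group_closed SOut_pred.
Proof.
have [cl1 clF] := SAut_closed.
split=> [|o p]; first by apply/asboolP; exists 1; rewrite ?gmulf1.
case/asboolP=> f Sf <- /asboolP[g Sg <-]; apply/asboolP.
by exists (f / g); [apply: clF | rewrite gmulfF].
Qed.

Record SOut : Type := MkSOut { SOut_out :> outg F; SOutP : SOut_pred SOut_out }.

HB.instance Definition _ := [isSub for SOut_out].
HB.instance Definition _ := [Choice of SOut by <:].
HB.instance Definition _ :=
  SubChoice_isSubGroup.Build (outg F) SOut_pred SOut SOut_closed.

End Abelianization.

Inductive group_kind := AutF | SAutF | OutF | SOutF | GLZ | SLZ.

Definition group_of (k : group_kind) (n : nat) : groupType :=
  match k with
  | AutF => autg (free_group n)
  | SAutF => SAut n
  | OutF => outg (free_group n)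
  | SOutF => SOut n
  | GLZ => GL n int
  | SLZ => SL n int
  end.

Definition to_GLZ (k : group_kind) (n : nat) : group_of k n -> GL n int :=
  match k return group_of k n -> GL n int with
  | AutF => fun f => aut_GL f
  | SAutF => fun f => aut_GL f
  | OutF => fun o => out_GL o
  | SOutF => fun o => out_GL o
  | GLZ => fun A => A
  | SLZ => fun A => A
  end.

Fact to_GLZM k n : {morph @to_GLZ k n : x y / x * y}.
Proof.
by case: k => x y //=; [apply: aut_GLM | apply: aut_GLM | apply: out_GLM |
  apply: out_GLM].
Qed.

HB.instance Definition _ k n :=
  isGroupMorphism.Build (group_of k n) (GL n int) (@to_GLZ k n)
    (morph_divg (@to_GLZM k n)).

Definition natural_map (k : group_kind) (n : nat) (x : group_of k n) :
  SL n 'F_2 := mod2 (to_GLZ x).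

Fact natural_mapM k n : {morph @natural_map k n : x y / x * y}.
Proof. by move=> x y; rewrite /natural_map !gmulfM. Qed.

HB.instance Definition _ k n := isGroupMorphism.Build
  (group_of k n) (SL n 'F_2) (@natural_map k n)
    (morph_divg (@natural_mapM k n)).

Definition cyclic_group (H : groupType) : Prop :=
  exists h : H, forall x : H, exists m : nat, x = h ^+ m \/ x = h ^- m.

Definition isomorphic_groups (G H : groupType) : Prop :=
  exists f : {multiplicative G -> H}, bijective f.

(* |A| < |B|, for possibly infinite types. *)
Definition card_lt (A B : Type) : Prop :=
  ([set: A] #<= [set: B])%card /\ ~ ([set: B] #<= [set: A])%card.

(* Main.v *)
(* Write R_ij for x_i |-> x_i x_j and L_ij for x_i |-> x_j^-1 x_i.  The proof is
   an induction on n that only uses the commutation relations between these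
   transvections.  In a finite group K generated by a non-trivial system of such
   elements, fix o and let Q = <R_oj>, Q' = <L_oj>, N = N_K(Q), C = C_K(Q).
   The index of N in K is at least 2^n - 1: with u_S the product of the R_io,
   i in S, the cosets u_S N and L_oj u_S N (j in S) are pairwise distinct, as
   they are fixed by different transvections.  Moreover C contains Q', of order
   at least 2^(n-1), and N / C contains a non-trivial system of rank n - 1, so
   that |K| >= (2^n - 1) 2^(n-1) |SL(n-1, 2)| = |SL(n, 2)|.
   If equality holds, then L_ij = R_ij and R_ij^2 = 1, and K permutes the
   conjugates of Q in the way SL(n, 2) permutes the non-zero row vectors, so the
   kernel of q is contained in that of the natural map.
   Nielsen's theorem, proved by folding labelled graphs, and column reduction
   over the integers reduce the six groups to their transvections. *)
From HB Require Import structures.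
From mathcomp Require Import all_boot all_order all_algebra.
From mathcomp Require Import all_fingroup all_solvable boolp.
Require Import Defs.

Set Implicit Arguments.
Unset Strict Implicit.
Unset Printing Implicit Defensive.

Import GRing.Theory Num.Theory.
Local Open Scope group_scope.

(** * Transvection systems in a finite group *)

(** Nothing is known beforehand about the orders of the transvections, and two right transvections
    of the same row need not commute. So sizes can only be bounded through chains of proper
    inclusions, and two families are kept because a right and a left transvection of one row always
    commute. This makes Q' centralise Q although Q may be non-abelian, and it makes left
    transvections good test elements for the cosets of N. Passing to N / C loses no information
    about powers: N acts on Q by conjugation with kernel C, and powers in the quotient can be read
    off in row [o]. Thus non-triviality descends and order 2 ascends. A product of three lower
    bounds is attained only if each of them is, which drives the case of equality. The action on
    conjugates of Q gives only one inclusion of kernels; the other is obtained by counting. Where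
    transvections generate a subgroup of index 2, an element of determinant -1 needs an argument of
    its own. *)

(* Satisfied by X false i j : x_i |-> x_i x_j and
   X true i j : x_i |-> x_j^-1 x_i, where x ^ y is y^-1 x y and automorphisms
   are composed from right to left; the values X c i i are irrelevant. *)
Definition transv_rel (I : finType) (gT : groupType) (X : bool -> I -> I -> gT)
  : Prop :=
  [/\ forall c i j k, i != j -> i != k -> j != k ->
        X c i j ^ X false j k = X c i j * (X c i k)^-1,
      forall c i j k, i != j -> i != k -> j != k ->
        X c i j ^ X true j k = X c i k * X c i j,
      forall b c i j k l, i != j -> k != l -> i != k -> i != l -> j != k ->
        commute (X b i j) (X c k l)
    & forall i j k, i != j -> i != k -> commute (X false i j) (X true i k)].

Section Transvections.

Variables (I : finType) (gT : finGroupType) (X : bool -> I -> I -> gT).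
Hypotheses (relX : transv_rel X) (I_ge3 : 2 < #|I|).

Lemma ex_third (i j : I) : exists k, (k != i) && (k != j).
Proof.
apply/existsP; apply: contraT; rewrite negb_exists => /forallP all_ij.
have /subset_leq_card : [set: I] \subset [set i; j].
  by apply/subsetP=> k _; rewrite !inE; have := all_ij k;
    rewrite negb_and !negbK.
by rewrite cardsT cards2 leqNgt (leq_ltn_trans _ I_ge3) //; case: (i != j).
Qed.

Lemma transv_eq1_row c i j : i != j -> X c i j = 1 ->
  forall k, i != k -> X c i k = 1.
Proof.
case: relX => r1 _ _ _ ij Xij k ik.
have [<-//|jk] := eqVneq j k.
have := r1 c i j k ij ik jk; rewrite Xij conj1g mul1g => /eqP.
by rewrite eq_sym invg_eq1 => /eqP.
Qed.

Lemma transv_eq1_other c i j : i != j -> X c i j = 1 ->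
  forall c' k l, k != i -> k != l -> X c' k l = 1.
Proof.
case: relX => r1 r2 _ _ ij Xij c' k l ki kl.
have [m /andP[mi mk]] := ex_third i k.
have Xim : X c i m = 1 by apply: transv_eq1_row Xij _ _; rewrite // eq_sym.
apply: (@transv_eq1_row _ _ m) => //; first by rewrite eq_sym.
rewrite !(eq_sym m) in mi mk.
case: c Xim {Xij} => Xim.
  have := r2 c' k i m ki mk mi; rewrite Xim conjg1 => /eqP.
  by rewrite eq_sym eq_mulgV1 mulgK => /eqP.
have := r1 c' k i m ki mk mi; rewrite Xim conjg1 => /eqP.
by rewrite eq_mulVg1 mulKg invg_eq1 => /eqP.
Qed.

(** A trivial element kills its row, because conjugating it produces the other elements of that row,
    and then it kills all other rows, because conjugating by it has no effect. Row [i] for the other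
    value of [c] is reached through a third row. *)
Lemma transv_eq1 c i j : i != j -> X c i j = 1 ->
  forall c' k l, k != l -> X c' k l = 1.
Proof.
move=> ij Xij c' k l kl; have [m /andP[mk mi]] := ex_third k i.
have [n /andP[nm _]] := ex_third m m.
have Xmn : X c m n = 1 by apply: transv_eq1_other Xij _ _ _ _ _;
  rewrite // eq_sym.
by apply: transv_eq1_other Xmn _ _ _ _ _ => //; rewrite eq_sym.
Qed.

Definition transv_grp := <<[set X p.1.1 p.1.2 p.2 | p : bool * I * I & p.1.2 !=
  p.2]>>.
Canonical transv_group := [group of transv_grp].

Lemma transv_in c i j : i != j -> X c i j \in transv_grp.
Proof.
move=> ij; apply/mem_gen/imsetP; exists (c, i, j) => //.
by rewrite inE.
Qed.

Lemma transv_grp_sub (G : {group gT}) :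
  (forall c i j, i != j -> X c i j \in G) -> transv_grp \subset G.
Proof.
move=> XG; rewrite gen_subG; apply/subsetP => _ /imsetP[[[c i] j] + ->].
by rewrite inE; apply: XG.
Qed.

Definition row_grp c o := <<[set X c o j | j : I & o != j]>>.
Canonical row_group c o := [group of row_grp c o].

Lemma row_in c o j : o != j -> X c o j \in row_grp c o.
Proof. by move=> oj; apply/mem_gen/imsetP; exists j; rewrite ?inE. Qed.

Lemma row_sub c o (G : {group gT}) :
  (forall j, o != j -> X c o j \in G) -> row_grp c o \subset G.
Proof.
move=> XG; rewrite gen_subG; apply/subsetP => _ /imsetP[j + ->].
by rewrite inE; apply: XG.
Qed.

Lemma row_sub_transv c o : row_grp c o \subset transv_grp.
Proof. by apply: row_sub => j; apply: transv_in. Qed.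

Lemma row_cent o : row_grp true o \subset 'C(row_grp false o).
Proof.
case: relX => _ _ _ r4.
apply: row_sub => j oj; rewrite -sub_cent1; apply: row_sub => k ok.
by apply/cent1P; first [exact: r4 | exact: commute_sym (r4 _ _ _ _ _)].
Qed.

Lemma norm_gen_in (S : {set gT}) x :
  {in S, forall y, y ^ x \in <<S>>} -> x \in 'N(<<S>>).
Proof.
move=> Sx; rewrite inE -genJ gen_subG.
by apply/subsetP=> _ /imsetP[y Sy ->]; apply: Sx.
Qed.

Lemma row_norm b c o i j : o != i -> o != j -> i != j ->
  X b i j \in 'N(row_grp c o).
Proof.
case: relX => r1 r2 r3 _ oi oj ij; apply: norm_gen_in => _ /imsetP[k + ->].
rewrite inE => ok; rewrite -/(row_grp c o).
have [<-|ki] := eqVneq i k.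
  case: b; rewrite ?r1 ?r2 // groupM ?groupV ?row_in //.
suff -> : X c o k ^ X b i j = X c o k by apply: row_in.
by apply/conjg_fixP/commgP; apply: r3; rewrite // eq_sym.
Qed.

Hypothesis ntX : forall c i j, i != j -> X c i j != 1.

(** Otherwise the commutator of [X b j o] with [X false o k], which is the inverse of [X b j k],
    would lie in the right row group. It would then commute with [X true o j], and this forces
    [X true o k] to be trivial. *)
Lemma row_notin_norm b o j : j != o -> X b j o \notin 'N(row_grp false o).
Proof.
case: relX => r1 r2 _ r4 jo; apply/negP => nQ.
have [k /andP[kj ko]] := ex_third j o.
rewrite !(eq_sym k) in kj ko.
have oj : o != j by rewrite eq_sym.
have Q_ok : X false o k \in row_grp false o by apply: row_in.
have Q_jk : X b j k \in row_grp false o.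
  have := r1 b j o k jo kj ko => /(congr1 (fun z => (X b j o)^-1 * z)).
  rewrite mulKg /conjg mulgA => E.
  rewrite -groupV -E (_ : _ * _ = (X false o k)^-1 ^ X b j o * X false o k).
    by rewrite groupM // memJ_norm ?groupV.
  by rewrite /conjg !mulgA.
have cjk : commute (X b j k) (X true o j).
  apply: commute_sym; apply/(centP (subsetP (row_cent o) _ _)) => //.
  by apply: row_in.
have := ntX true ko; case/eqP.
have : X true o j ^ X b j k = X true o j.
  by apply/conjg_fixP/commgP/commute_sym.
case: b nQ Q_jk cjk => nQ Q_jk cjk; rewrite ?r1 ?r2 // => /eqP.
  by rewrite eq_mulgV1 mulgK => /eqP.
by rewrite eq_sym eq_mulVg1 mulKg invg_eq1 => /eqP.
Qed.

Definition part_row c o (S : {set I}) := <<[set X c o j | j in S]>>.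

(** For a third index [k], the element [X false j k] commutes with all generators of the part but
    not with [X c o j]. *)
Lemma row_notin_part c o (S : {set I}) j :
  o != j -> o \notin S -> j \notin S -> X c o j \notin part_row c o S.
Proof.
case: relX => r1 _ r3 _ oj oS jS; apply/negP => Xj.
have [k /andP[]] := ex_third j o; rewrite !(eq_sym k) => jk ok.
have : part_row c o S \subset 'C[X false j k].
  rewrite gen_subG; apply/subsetP => _ /imsetP[i Si ->]; apply/cent1P.
  have oi : o != i by apply: contraNneq oS => ->.
  have ji : j != i by apply: contraNneq jS => ->.
  by apply: r3; rewrite // eq_sym.
move=> /subsetP/(_ _ Xj)/cent1P/commgP/conjg_fixP.
rewrite r1 // => /eqP; rewrite eq_sym eq_mulVg1 mulKg invg_eq1.
by rewrite (negPf (ntX c ok)).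
Qed.

(** Each further index enlarges the subgroup properly, hence at least doubles it by Lagrange,
    whatever the orders of the generators. *)
Lemma card_part_row c o (S : {set I}) : o \notin S -> 2 ^ #|S| <= #|part_row c o
  S|.
Proof.
move En: #|S| => n; elim: n S En => [|n IHn] S En oS; first exact: cardG_gt0.
have [j Sj] : exists j, j \in S by apply/set0Pn; rewrite -card_gt0 En.
have oj : o != j by apply: contraNneq oS => ->.
have jS' : j \notin S :\ j by rewrite setD11.
have oS' : o \notin S :\ j by rewrite !inE negb_and oS orbT.
have sub : part_row c o (S :\ j) \subset part_row c o S.
  by apply/genS/imsetS/subD1set.
rewrite expnSr -(Lagrange sub) leq_mul //.
  by apply: IHn => //; move: (cardsD1 j S); rewrite Sj En; case.
rewrite indexg_gt1; apply: contra (row_notin_part c oj oS' jS') => /subsetP;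
  apply.
by apply/mem_gen/imset_f.
Qed.

Lemma card_row c o : 2 ^ #|I|.-1 <= #|row_grp c o|.
Proof.
have oC : o \notin [set~ o] by rewrite !inE eqxx.
have <- : #|[set~ o]| = #|I|.-1 by rewrite cardsC1.
apply: leq_trans (card_part_row c oC) _; apply/subset_leq_card/genS.
apply/subsetP => _ /imsetP[j + ->]; rewrite !inE => oj.
by apply/imsetP; exists j; rewrite // inE eq_sym.
Qed.

(** * The index of the normaliser of a row group *)

Section Cosets.

Variable o : I.
Local Notation N := ('N(row_grp false o)).
Let u (s : seq I) := \prod_(i <- s) X false i o.

Lemma row_in_norm j : o != j -> X false o j \in N.
Proof. by move=> oj; apply: (subsetP (normG _)); apply: row_in. Qed.

Lemma transv_norm c i j : o != i -> o != j -> i != j -> X c i j \in N.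
Proof. exact: row_norm. Qed.

Lemma conj_u_fix y s :
  {in s, forall i, commute y (X false i o)} -> y ^ u s = y.
Proof.
move=> cy; apply/conjg_fixP/commgP; rewrite /u big_seq.
by elim/big_ind: _ => //; [apply: commute1 | move=> v w; apply: commuteM].
Qed.

(** A left transvection [X true j k] commutes with [X false j o] even if [j] occurs in [s], so that
    only the factor with index [k] has an effect. *)
Lemma conj_u_true j k s : o \notin s -> uniq s -> o != j -> o != k -> j != k ->
  X true j k ^ u s = if k \in s then X true j k * (X true j o)^-1 else X true j
    k.
Proof.
case: relX => r1 _ r3 r4 os us oj ok jk.
have cX l i : o != i -> i != l -> j != l -> commute (X true j l) (X false i o).
  move=> oi il jl; have [<-|ij] := eqVneq i j.
    by apply/commute_sym/r4; rewrite // eq_sym.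
  by apply: r3; rewrite // eq_sym.
have os' (s' : seq I) i : o \notin s' -> i \in s' -> o != i.
  by move=> os1 si; apply: contraNneq os1 => ->.
case: ifP => [ks|/negbT ks]; last first.
  apply: conj_u_fix => i si; apply: cX; rewrite ?(os' s) //.
  by apply: contraNneq ks => <-.
move: os us; rewrite /u; case/splitPr: ks => s1 s2.
rewrite mem_cat inE !negb_or cat_uniq /= !negb_or => /and3P[os1 _ os2].
case/and3P=> _ /andP[k1 _] /andP[k2 _]; rewrite big_cat big_cons !conjgM /=.
rewrite -![\prod_(i <- _) _]/(u _) (conj_u_fix (s := s1)); last first.
  move=> i si; apply: cX; rewrite ?(os' s1) //.
  by apply: contraNneq k1 => <-.
have jo : j != o by rewrite eq_sym.
have ko : k != o by rewrite eq_sym.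
rewrite r1 // conjMg conjVg; congr (_ * _^-1); apply: conj_u_fix => i si.
  apply: cX; rewrite ?(os' s2) //.
  by apply: contraNneq k2 => <-.
by apply: cX; rewrite ?(os' s2) // eq_sym ?(os' s2).
Qed.

Lemma conj_u_col j s : o \notin s -> o != j -> X true j o ^ u s = X true j o.
Proof.
case: relX => r1 _ r3 r4 os oj; apply: conj_u_fix => i si.
have oi : o != i by apply: contraNneq os => ->.
have [<-|ij] := eqVneq i j.
  by apply/commute_sym/r4; rewrite // eq_sym.
by apply: r3; rewrite // eq_sym.
Qed.

Lemma conj_u_row k s : o \notin s -> uniq s -> k \notin s -> o != k ->
  X false o k ^ u s \in N.
Proof.
case: relX => r1 _ r3 _ + + + ok; elim: s => [|i s IHs].
  by rewrite /u big_nil conjg1 row_in_norm.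
rewrite !in_cons !negb_or => /andP[oi os] /=/andP[si us] /andP[ki ks].
rewrite /u big_cons conjgM.
have -> : X false o k ^ X false i o = X false o k * X false i k.
  have := r1 false i o k; rewrite !(eq_sym i) => /(_ oi ki ok).
  move/(congr1 (fun z => X false o k * ((X false i o)^-1 * z)^-1)).
  by rewrite mulKg invgK => <-; rewrite /conjg !invMg !invgK !mulgA mulgV mul1g.
rewrite conjMg -/(u _) groupM //; first exact: IHs.
rewrite conj_u_fix; first by apply: transv_norm; rewrite // eq_sym.
move=> j sj; have oj : o != j by apply: contraNneq os => ->.
have ij : i != j by apply: contraNneq si => ->.
have kj : k != j by apply: contraNneq ks => ->.
by apply: r3; rewrite // eq_sym.
Qed.

Lemma fix_u_true j k s : o \notin s -> uniq s -> o != j -> o != k -> j != k ->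
  (X true j k ^ u s \in N) = (k \notin s).
Proof.
move=> os us oj ok jk; rewrite conj_u_true //; case: ifP => ks /=.
  rewrite groupMl ?transv_norm // groupV; apply/negbTE/row_notin_norm.
  by rewrite eq_sym.
by rewrite transv_norm.
Qed.

Lemma fix_u_row k s : o \notin s -> uniq s -> o != k ->
  (X false o k ^ u s \in N) = (k \notin s).
Proof.
move=> os us ok; have [ks|ks] := boolP (k \in s); last exact: conj_u_row.
case: relX => r1 _ r3 _; apply/negP => Nok.
have [m /andP[]] := ex_third k o; rewrite !(eq_sym m) => km om.
(* [y] is chosen so that [u s] conjugates it into N. If [X false o k] were conjugated into N as
   well, so would be [y ^ X false o k], hence also [X true m k], against [fix_u_true]. *)
pose y := X true m k * X true m o.
have yu : y ^ u s = X true m k.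
  by rewrite conjMg conj_u_true ?ks 1?(eq_sym m) // conj_u_col ?mulgVK.
have mo : m != o by rewrite eq_sym.
have mk : m != k by rewrite eq_sym.
have yX : y ^ X false o k = y * (X true m k)^-1.
  rewrite conjMg (r1 _ m o k) // mulgA; congr (_ * _ * _).
  by apply/conjg_fixP/commgP; apply: r3; rewrite // eq_sym.
have : (y ^ X false o k) ^ u s \in N.
  by rewrite conjJg yu groupJ // transv_norm.
rewrite yX conjMg conjVg groupMl; last by rewrite yu transv_norm.
by rewrite groupV fix_u_true // ks.
Qed.

(** This separates the two families of cosets: [u s] alone leaves [X true m o] outside N, while the
    factor [X true o j] adds an [X true m j], whose conjugate by [u s] ends in the inverse of
    [X true m o]. *)
Lemma fix_true_u_col m j s : o \notin s -> uniq s -> o != m -> o != j ->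
  m != j -> j \in s -> X true m o ^ (X true o j * u s) \in N.
Proof.
case: relX => r1 r2 r3 _ os us om oj mj js.
have mo : m != o by rewrite eq_sym.
by rewrite conjgM r2 // conjMg conj_u_true // js conj_u_col ?mulgVK
  ?transv_norm.
Qed.

Lemma fix_true_u_row k j s : o \notin s -> uniq s -> o != k -> o != j ->
  (X false o k ^ (X true o j * u s) \in N) = (k \notin s).
Proof.
case: relX => _ _ _ r4 os us ok oj; rewrite conjgM -(fix_u_row os us ok).
congr (_ ^ _ \in N); apply/conjg_fixP/commgP; exact: r4.
Qed.

Lemma fix_coset y g h : g^-1 * h \in N -> (y ^ g \in N) = (y ^ h \in N).
Proof. by move=> Ngh; rewrite -(groupJr (y ^ g) Ngh) -conjgM mulKVg. Qed.

(** In SL(n, 2) the subgroup N is the stabiliser of the row vector e_o; there u_S stands for the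
    vector with support [o |: S] and L_oj u_S for the one with support [S]. Any [j] in [S] would do,
    and the value 1 at the empty set is a filler that [dom] excludes. *)
Let rep (p : bool * {set I}) : gT :=
  if p.1 then if [pick j in p.2] is Some j then X true o j * u (enum p.2) else 1
  else u (enum p.2).

Let dom := [set p : bool * {set I} | (o \notin p.2) && (p.1 ==> (p.2 != set0))].

Let rep_in p : p \in dom -> rep p \in transv_grp.
Proof.
case: p => b S; rewrite inE /= /rep /= => /andP[oS _].
have uS : u (enum S) \in transv_grp.
  rewrite /u big_seq; apply: group_prod => i; rewrite mem_enum => iS.
  by apply: transv_in; apply: contraNneq oS => <-.
case: b => //; case: pickP => [j /= Sj|_]; last exact: group1.
by rewrite groupM // transv_in //; apply: contraNneq oS => ->.
Qed.

(** The test element depends on [b]: [X false o k] commutes with [X true o j] and so does not notice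
    this additional factor. *)
Let fix_rep b (S : {set I}) k m : o \notin S -> b ==> (S != set0) -> o != k -> o
  != m ->
    m != k ->
  ((if b then X false o k else X true m k) ^ rep (b, S) \in N) = (k \notin S).
Proof.
move=> oS nS ok om mk; have oS' : o \notin enum S by rewrite mem_enum.
have uS := enum_uniq S; rewrite /rep -(mem_enum S) /=.
case: b nS => /= nS; last by rewrite fix_u_true.
case: pickP => [j /= Sj|S0]; last by case/set0Pn: nS => j; rewrite S0.
by rewrite fix_true_u_row //; apply: contraNneq oS => ->.
Qed.

Let rep_inj p q : p \in dom -> q \in dom -> (rep p)^-1 * rep q \in N -> p = q.
Proof.
case: p q => b S [c T] pD qD Npq; move: pD qD.
rewrite !inE /= => /andP[oS nS] /andP[oT nT].
have neq c' (S' T' : {set I}) : o \notin S' -> o \notin T' -> c' ==> (S' !=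
  set0) ->
  c' ==> (T' != set0) -> (rep (c', S'))^-1 * rep (c', T') \in N -> S' = T'.
  move=> oS' oT' nS' nT' N'; apply/setP => k.
  have [->|ko] := eqVneq k o; first by rewrite (negPf oS') (negPf oT').
  have [m /andP[mk mo]] := ex_third k o; rewrite eq_sym in ko;
    rewrite eq_sym in mo.
  apply: negb_inj; rewrite -(fix_rep oS' nS' ko mo mk) -(fix_rep oT' nT' ko mo
    mk).
  exact: fix_coset.
have mixed (S' T' : {set I}) : o \notin S' -> o \notin T' -> S' != set0 ->
    (rep (true, S'))^-1 * rep (false, T') \in N -> False.
  move=> oS' oT'; rewrite /rep /=; case: pickP => [j Sj _|S0]; last first.
    by case/set0Pn => j; rewrite S0.
  have oj : o != j by apply: contraNneq oS' => ->.
  have [m /andP[]] := ex_third j o; rewrite !(eq_sym m) => jm om.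
  have mj : m != j by rewrite eq_sym.
  move/(fix_coset (X true m o)); rewrite fix_true_u_col ?mem_enum ?enum_uniq //.
  rewrite conj_u_col ?mem_enum // => /esym; apply/negP/row_notin_norm.
  by rewrite eq_sym.
case: b c nS nT Npq => [] [] /= nS nT Npq.
- by rewrite (neq true S T oS oT nS nT Npq).
- by case: (mixed S T).
- case: (mixed T S) => //.
  by rewrite -groupV invMg invgK.
by rewrite (neq false S T oS oT nS nT Npq).
Qed.

Let card_dom : #|dom| = (2 ^ #|I|).-1.
Proof.
have oC (S : {set I}) : (S \in powerset [set~ o]) = (o \notin S).
  by rewrite powersetE subsetC sub1set inE.
have -> : dom = setX [set: bool] (powerset [set~ o]) :\ (true, set0).
  apply/setP => [[b S]]; rewrite !inE /= -oC powersetE xpair_eqE.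
  by case: b; rewrite ?andbT //= andbC.
have := cardsD1 (true, set0) (setX [set: bool] (powerset [set~ o])).
rewrite in_setX in_setT oC in_set0 add1n cardsX cardsT card_bool card_powerset.
rewrite cardsC1.
by rewrite -expnS (ltn_predK I_ge3) => ->.
Qed.

Lemma index_norm_row :
  (2 ^ #|I|).-1 <= #|transv_grp : 'N_(transv_grp)(row_grp false o)|.
Proof.
rewrite -card_dom -card_lcosets -(card_in_imset (f := fun p =>
  rep p *: 'N_(transv_grp)(row_grp false o))).
  apply/subset_leq_card/subsetP => _ /imsetP[p pD ->].
  by apply/lcosetsP; exists (rep p) => //; apply: rep_in.
move=> p q pD qD /= /lcoset_eqP; rewrite mem_lcoset => /setIP[_].
move=> Npq; apply: rep_inj => //.
by rewrite -groupV invMg invgK.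
Qed.

End Cosets.

End Transvections.

(** The order of SL(n, 2), computed from the number of non-zero row vectors and the stabiliser of
    one of them. *)
Fixpoint sl2_card n := if n is m.+1 then ((2 ^ n).-1 * 2 ^ m * sl2_card m)%N
  else 1%N.

Lemma sl2_card_gt0 n : 0 < sl2_card n.
Proof.
elim: n => //= n IHn; rewrite !muln_gt0 IHn expn_gt0 andbT /=.
by rewrite -subn1 subn_gt0 -{1}(expn0 2) ltn_exp2l.
Qed.

Lemma leq_mul_eq a b c d : 0 < a -> 0 < b -> a <= c -> b <= d -> (c * d <= a *
  b)%N ->
  a = c /\ b = d.
Proof.
move=> a0 b0 ac bd cd; split; apply/eqP; rewrite eqn_leq ?ac ?bd /=.
  by rewrite -(leq_pmul2r b0) (leq_trans _ cd) // leq_mul.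
by rewrite -(leq_pmul2l a0) (leq_trans _ cd) // leq_mul.
Qed.

Lemma transv_rel_morphim (I J : finType) (gT rT : finGroupType)
    (G : {group gT}) (f : {morphism G >-> rT}) (h : J -> I)
    (X : bool -> I -> I -> gT) :
  injective h -> (forall c i j, i != j -> X c (h i) (h j) \in G) ->
  transv_rel X -> transv_rel (fun c i j => f (X c (h i) (h j))).
Proof.
move=> h_inj XG [r1 r2 r3 r4].
have hE i j : i != j -> h i != h j by rewrite (inj_eq h_inj).
split.
- by move=> c i j k ij ik jk; rewrite -morphJ ?XG // r1 ?hE // morphM ?morphV
    ?groupV ?XG.
- by move=> c i j k ij ik jk; rewrite -morphJ ?XG // r2 ?hE // morphM ?XG.
- move=> b c i j k l ij kl ik il jk; rewrite /commute -!morphM ?XG //.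
  by congr (f _); apply: r3; rewrite hE.
move=> i j k ij ik; rewrite /commute -!morphM ?XG //.
by congr (f _); apply: r4; rewrite hE.
Qed.

(** * The induction step: from K to N / C *)

Section Step.

Variables (I : finType) (gT : finGroupType) (X : bool -> I -> I -> gT).
Hypotheses (relX : transv_rel X) (I_ge3 : 2 < #|I|).
Hypothesis ntX : forall c i j, i != j -> X c i j != 1.
Variable o : I.

Local Notation K := (transv_group X).
Local Notation Q := (row_group X false o).
Local Notation N := ('N_K(Q))%G.
Local Notation C := ('C_K(Q))%G.
Local Notation J := {x : I | o != x}.
Local Notation Y := (fun c (i j : J) => coset C (X c (val i) (val j))).

Let oJ (i : J) : o != val i. Proof. exact: (valP i). Qed.
Let ovJ (i j : J) : i != j -> val i != val j. Proof. by rewrite (inj_eq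
  val_inj). Qed.

Lemma transv_in_normaliser c (i j : J) : i != j -> X c (val i) (val j) \in N.
Proof. move=> ij; apply/setIP; split; first by apply: transv_in; apply: ovJ.
exact: (row_norm relX c false (oJ i) (oJ j) (ovJ ij)). Qed.

Lemma normaliser_sub_normC : N \subset 'N(C).
Proof. by case/andP: (subcent_normal K Q). Qed.

Let XNC c (i j : J) : i != j -> X c (val i) (val j) \in 'N(C).
Proof. by move=> ij; rewrite (subsetP normaliser_sub_normC)
  ?transv_in_normaliser. Qed.

Lemma transv_rel_quotient : transv_rel Y.
Proof. by apply: transv_rel_morphim relX => //; apply: val_inj. Qed.

Lemma card_quotient_index : #|{: J}| = #|I|.-1.
Proof. by rewrite card_sig -(cardC1 o); apply: eq_card => x;
  rewrite !inE eq_sym. Qed.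

Lemma conj_row_exp j k m : o != j -> o != k -> j != k ->
  X false o j ^ (X false j k ^+ m) = X false o j * (X false o k) ^- m.
Proof.
case: relX => r1 _ r3 _ oj ok jk; elim: m => [|m IHm].
  by rewrite expg0 conjg1 invg1 mulg1.
rewrite expgSr conjgM IHm conjMg r1 // -mulgA; congr (_ * _).
rewrite conjVg conjXg (_ : X false o k ^ _ = X false o k);
  first by rewrite -invMg -expgSr.
by apply/conjg_fixP/commgP; apply: r3; rewrite // eq_sym.
Qed.

(** The power multiplies [X false o (val j)] by an inverse power of [X false o (val k)] and fixes
    the other generators of Q. This is what transfers orders between the quotient and row [o]. *)
Lemma exp_in_cent (j k : J) m : j != k ->
  (X false (val j) (val k) ^+ m \in C) = (X false o (val k) ^+ m == 1).
Proof.
move=> jk; have := ovJ jk; have := oJ j; have := oJ k.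
move: (val j) (val k) => {}j {}k ok oj {}jk.
rewrite inE groupX ?transv_in //=; apply/idP/eqP => [|Em].
  rewrite -sub_cent1 => /subsetP/(_ _ (row_in X false
    oj))/cent1P/commgP/conjg_fixP.
  by rewrite conj_row_exp // => /eqP; rewrite eq_sym eq_mulVg1 mulKg invg_eq1 =>
    /eqP.
case: relX => r1 _ r3 _.
rewrite -sub_cent1; apply: row_sub => i oi; apply/cent1P/commgP/conjg_fixP.
have [->|ij] := eqVneq i j; first by rewrite conj_row_exp // Em invg1 mulg1.
by apply/conjg_fixP/commgP/commuteX; apply: r3; rewrite // eq_sym.
Qed.

Lemma quotient_exp (j k : J) m : j != k ->
  (Y false j k ^+ m == 1) = (X false o (val k) ^+ m == 1).
Proof.
move=> jk; rewrite -morphX ?XNC // -(exp_in_cent m jk).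
apply/eqP/idP; first by apply: coset_idr; rewrite groupX ?XNC.
exact: coset_id.
Qed.

Local Notation Kbar := (transv_group Y).

Lemma transv_quotient_sub : Kbar \subset N / C.
Proof.
apply: transv_grp_sub => c i j ij.
by rewrite mem_quotient // transv_in_normaliser.
Qed.

Lemma cent_row_gt : 2 ^ #|I|.-1 <= #|C|.
Proof.
apply: leq_trans (card_row relX I_ge3 ntX true o) _; apply: subset_leq_card.
by rewrite subsetI row_sub_transv (row_cent relX).
Qed.

Lemma card_transv_split :
  #|K| = (#|C| * #|N / C| * #|K : N|)%N.
Proof.
have sCN : C \subset N by case/andP: (subcent_normal K Q).
have sNK : N \subset K by apply: subsetIl.
rewrite -(Lagrange sNK); congr (_ * _)%N.
by rewrite card_quotient ?normaliser_sub_normC // Lagrange.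
Qed.

Lemma ntX_quotient (j k : J) : j != k -> Y false j k != 1.
Proof.
move=> jk; have := quotient_exp 1 jk; rewrite !expg1 => ->.
by apply: ntX.
Qed.

Section Equality.

Hypothesis sq1 : forall j, o != j -> X false o j ^+ 2 = 1.

Let invX j : o != j -> (X false o j)^-1 = X false o j.
Proof. by move=> oj; apply/eqP; rewrite eq_invg_mul -expg2 sq1. Qed.

(** The product of two generators is conjugate to a generator, so it is an involution too, and
    involutions with an involutory product commute. *)
Lemma row_abelian : abelian Q.
Proof.
case: relX => r1 _ _ _; rewrite /abelian.
apply: row_sub => j oj; rewrite -sub_cent1; apply: row_sub => k ok.
apply/cent1P; have [->//|jk] := eqVneq j k.
have := congr1 (conjg^~ (X false j k)) (sq1 oj).
rewrite /= conj1g conjXg r1 // invX // expg2 => /eqP.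
rewrite -eq_invg_mul invMg !invX // => /eqP jkC.
by rewrite /commute -jkC.
Qed.

(** If a generator with index [i != j] occurred in [z], conjugation by [X false i j] would change
    [z] by [X false o j], since it fixes the remaining generators. *)
Lemma part_row_fixed j (S : {set I}) z : o != j -> o \notin S ->
    z \in part_row X false o S ->
    (forall i, i \in S -> i != j -> commute z (X false i j)) ->
  z \in <[X false o j]>.
Proof.
case: relX => r1 _ r3 _ oj; move En: #|S| => n.
elim: n S z En => [|n IHn] S z En oS zS cz.
  move: zS; rewrite (cards0_eq En) /part_row imset0 gen0 => /set1P ->.
  exact: group1.
have oSi i : i \in S -> o != i by move=> Si; apply: contraNneq oS => ->.
have partC (T : {set I}) : o \notin T -> part_row X false o T \subset Q.
  move=> oT; apply/genS/subsetP => _ /imsetP[i Ti ->]; apply/imsetP;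
    exists i => //.
  by rewrite inE; apply: contraNneq oT => ->.
have [/existsP[i /andP[Si ij]] | noS] := boolP [exists i, (i \in S) && (i !=
  j)]; last first.
  have Sj : S \subset [set j].
    apply/subsetP => i Si; rewrite inE; apply: contraR noS => ij.
    by apply/existsP; exists i; rewrite Si.
  move: zS; apply/subsetP; rewrite gen_subG; apply/subsetP => _ /imsetP[i + ->].
  by move/(subsetP Sj)/set1P ->; apply: cycle_id.
have oi := oSi i Si.
have oS' : o \notin S :\ i by rewrite !inE negb_and oS orbT.
have zmul : z \in part_row X false o (S :\ i) * <[X false o i]>.
  have cc : <[X false o i]> \subset 'C(part_row X false o (S :\ i)).
    apply: subset_trans (centS (partC _ oS')); apply: subset_trans row_abelian.
    by rewrite cycle_subG; apply: row_in.
  rewrite -cent_joinEr // joing_idl joing_idr.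
  move: zS; apply/subsetP/genS; rewrite -{1}(setD1K Si) imsetU1.
  by rewrite setUC.
case/mulsgP: zmul cz => y r yS.
have X1 : X false o i != 1 by apply: ntX.
have ord2 : #[X false o i] = 2 by apply: nt_prime_order; rewrite ?sq1.
rewrite cycle2g // => /set2P[] -> ->.
  rewrite mulg1 => cy; apply: IHn yS _ => //.
    by move: (cardsD1 i S); rewrite Si En; case.
  by move=> k /setD1P[_ Sk] kj; apply: cy.
move/(_ i Si ij)/commgP/conjg_fixP; rewrite conjMg.
have -> : y ^ X false i j = y.
  apply/conjg_fixP/commgP/cent1P; move: yS; apply/subsetP.
  rewrite gen_subG; apply/subsetP => _ /imsetP[k /setD1P[ki Sk] ->].
  by have ok := oSi k Sk; apply/cent1P; apply: r3; rewrite // eq_sym.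
rewrite r1 // => /mulgI/eqP; rewrite eq_sym eq_mulVg1 mulKg invg_eq1.
by rewrite (negPf (ntX false oj)).
Qed.

(** Both row groups lie in C and have at least as many elements as C is allowed, so the three
    coincide. Hence [X true o j] is in Q, and as it commutes with all [X false i j] it is a power of
    the involution [X false o j]. *)
Lemma row_true_eq : #|C| <= 2 ^ #|I|.-1 -> forall j, o != j -> X true o j = X
  false o j.
Proof.
case: relX => r1 _ r3 _ leC j oj.
have Q'C : row_group X true o \subset C.
  by rewrite subsetI row_sub_transv (row_cent relX).
have QC : Q \subset C by rewrite subsetI row_sub_transv; apply: row_abelian.
have sizeQ c : #|C| <= #|row_group X c o|.
  by apply: leq_trans leC (card_row relX I_ge3 ntX c o).
have EQ : row_group X true o = Q :> {set _}.
  have /eqP -> : row_group X true o == C :> {set _} by rewrite eqEcard Q'C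
    sizeQ.
  by apply/esym/eqP; rewrite eqEcard QC sizeQ.
have : X true o j \in part_row X false o [set~ o].
  have -> : part_row X false o [set~ o] = Q.
    congr <<_>>; apply/setP => x.
    by apply/imsetP/imsetP => -[i Si ->]; exists i; move: Si;
      rewrite // !inE eq_sym.
  by rewrite -EQ; apply: row_in.
have oC : o \notin [set~ o] by rewrite !inE eqxx.
move/(part_row_fixed oj oC) => fixed.
have := ntX true oj.
have X1 := ntX false oj.
have ord2 : #[X false o j] = 2 by apply: nt_prime_order; rewrite ?sq1.
suff /set2P[->|->//] : X true o j \in [set 1; X false o j] by rewrite eqxx.
rewrite -cycle2g //; apply: fixed => i; rewrite !inE => io ij.
by apply: r3; rewrite // eq_sym.
Qed.

End Equality.

(** The two elements are conjugate to a quotient of each other and to its inverse. *)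
Lemma order_row_eq j k : o != j -> o != k -> j != k ->
  #[X false o j] = #[X false o k].
Proof.
case: relX => r1 _ _ _ oj ok jk; have kj : k != j by rewrite eq_sym.
rewrite -(orderJ _ (X false j k)) r1 // -[RHS](orderJ _ (X false k j)) r1 //.
by rewrite -[RHS]orderV invMg invgK.
Qed.

Lemma coset_conj_row x y j : o != j -> x \in N -> y \in N ->
  coset C x = coset C y -> X false o j ^ x = X false o j ^ y.
Proof.
move=> oj Nx Ny Exy; have NCx z : z \in N -> z \in 'N(C).
  exact/subsetP/normaliser_sub_normC.
have : x * y^-1 \in C.
  apply: coset_idr; first by rewrite groupM ?groupV ?NCx.
  by rewrite morphM ?groupV ?NCx // morphV ?NCx //= Exy mulgV.
case/setIP=> _ /centP/(_ _ (row_in X false oj))/commute_sym/commgP/conjg_fixP E.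
by rewrite -{2}E -conjgM mulgVK.
Qed.

(** The two products conjugate [X false o (val j)] to elements that differ by one non-trivial
    factor, so they act differently on Q. *)
Lemma quotient_noncomm (j k : J) : j != k -> Y false j k * Y false k j <> Y
  false k j * Y false j k.
Proof.
case: relX => r1 _ r3 _ jk; have kj : k != j by rewrite eq_sym.
rewrite -!morphM ?XNC //.
move/(coset_conj_row (oJ j) (groupM (transv_in_normaliser false jk)
  (transv_in_normaliser false kj)) (groupM (transv_in_normaliser false kj)
  (transv_in_normaliser false jk))).
have := ovJ jk; have := oJ j; have := oJ k; move: (val j) (val k) =>
  a b ob oa ab.
have ba : b != a by rewrite eq_sym.
have fix_a : X false o a ^ X false b a = X false o a.
  by apply/conjg_fixP/commgP; apply: r3; rewrite // eq_sym.
rewrite !conjgM fix_a r1 // conjMg fix_a conjVg r1 // invMg invgK => /mulgI/eqP.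
by rewrite eq_mulgV1 mulgK; apply/negP/ntX.
Qed.

(* Replaces the induction hypothesis when n = 3: a transvection system of rank 2
   may generate a group with fewer than 6 elements. *)
Lemma rank2_quotient (j k : J) : j != k ->
  6 <= #|Kbar| /\ (#|Kbar| = 6 -> X false o (val k) ^+ 2 = 1).
Proof.
move=> jk; have kj : k != j by rewrite eq_sym.
set r := Y false j k; set s := Y false k j; set d := #[X false o (val k)].
have Kr : r \in Kbar by apply: (transv_in Y).
have Ks : s \in Kbar by apply: (transv_in Y).
have order_quotient (a b : J) : a != b -> #[Y false a b] = #[X false o (val b)].
  move=> ab; apply/eqP; rewrite eqn_dvd !order_dvdn -(quotient_exp _ ab).
  by rewrite expg_order quotient_exp // expg_order !eqxx.
have ordr : #[r] = d by apply: order_quotient.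
have ords : #[s] = d by rewrite [LHS]order_quotient // (order_row_eq (oJ j) (oJ
  k) (ovJ jk)).
have tiRS : <[r]> :&: <[s]> = 1.
  apply/trivgP/subsetP => _ /setIP[/cycleP[m ->] /cycleP[l Erl]].
  rewrite inE (quotient_exp m jk); move: Erl; rewrite /r /s -!morphX ?XNC //.
  move/(coset_conj_row (oJ j) (groupX _ (transv_in_normaliser _ jk)) (groupX _
    (transv_in_normaliser _ kj))).
  rewrite (conj_row_exp _ (oJ j) (oJ k) (ovJ jk)).
  have -> : X false o (val j) ^ (X false (val k) (val j) ^+ l) = X false o (val
    j).
    case: relX => _ _ r3 _; apply/conjg_fixP/commgP/commuteX; 
    exact: (r3 _ _ _ _ _ _ (oJ j) (ovJ kj) (oJ k) (oJ j) (ovJ jk)).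
  by move/eqP; rewrite eq_sym eq_mulVg1 mulKg invg_eq1.
have d_gt1 : 1 < d by rewrite order_gt1 (ntX false (oJ k)).
have le_dd : d * d <= #|Kbar|.
  rewrite -{1}ordr -{1}ords -TI_cardMg //; apply/subset_leq_card.
  by rewrite mul_subG ?cycle_subG.
(* An order [d >= 3] gives at least 9 elements. For [d = 2] the group has even order at least 4, and
   a group of order 4 is abelian, contrary to [quotient_noncomm]. *)
have [d3|] := ltnP 2 d.
  have le9 : 9 <= #|Kbar| by apply: leq_trans le_dd; apply: (leq_mul d3 d3).
  by split; [apply: leq_trans le9 | move=> E; rewrite E in le9].
move=> d_le2; have d2 : d = 2 by apply/eqP; rewrite eqn_leq d_le2.
split; last by move=> _; rewrite -d2 expg_order.
rewrite leqNgt; apply/negP => K6; have := quotient_noncomm jk.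
case; suff /centsP cK : abelian Kbar by apply: cK.
apply: (@p2group_abelian _ 2); have K2 : 2 %| #|Kbar| by rewrite -d2 -ordr
  order_dvdG.
  by move: le_dd K2 K6; rewrite d2 /pgroup; case: #|_| => [|[|[|[|[|[|]]]]]].
by move: le_dd K2 K6; rewrite d2 /pgroup; case: #|_| => [|[|[|[|[|[|]]]]]].
Qed.

Lemma step_bound :
  sl2_card #|I|.-1 <= #|Kbar| ->
  (#|Kbar| = sl2_card #|I|.-1 -> forall j, o != j -> X false o j ^+ 2 = 1) ->
  sl2_card #|I| <= #|K| /\
  (#|K| = sl2_card #|I| -> forall j, o != j ->
     X true o j = X false o j /\ X false o j ^+ 2 = 1).
Proof.
move=> leKbar eqKbar; have I0 : #|I| = #|I|.-1.+1 by rewrite (ltn_predK I_ge3).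
have leNC : sl2_card #|I|.-1 <= #|N / C|.
  by apply: leq_trans leKbar (subset_leq_card transv_quotient_sub).
have leC := cent_row_gt.
have leI : (2 ^ #|I|).-1 <= #|K : N| := index_norm_row relX I_ge3 ntX o.
have sl2E : sl2_card #|I| = (2 ^ #|I|.-1 * sl2_card #|I|.-1 * (2 ^ #|I|).-1)%N.
  by rewrite {1}I0 /= -I0 -mulnA mulnC.
rewrite sl2E card_transv_split; split; first by rewrite !leq_mul.
have pos1 : 0 < 2 ^ #|I|.-1 by rewrite expn_gt0.
have pos2 : 0 < (2 ^ #|I|).-1.
  by rewrite -subn1 subn_gt0 -{1}(expn0 2) ltn_exp2l // (leq_trans _ I_ge3).
have pos3 := sl2_card_gt0 #|I|.-1.
move/eqP; rewrite eqn_leq => /andP[le _].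
have [|E1 _] := leq_mul_eq _ pos2 (leq_mul leC leNC) leI le.
  by rewrite muln_gt0 pos1.
have [] := leq_mul_eq pos1 pos3 leC leNC; first by rewrite E1.
move=> EC ENC; have sq1 : forall j, o != j -> X false o j ^+ 2 = 1.
  apply: eqKbar; apply/eqP; rewrite eqn_leq leKbar andbT ENC.
  exact: subset_leq_card transv_quotient_sub.
move=> j oj; split; last exact: sq1.
by apply: row_true_eq; rewrite // -EC.
Qed.

End Step.

Theorem transv_bound (I : finType) (gT : finGroupType) (X : bool -> I -> I ->
  gT) :
    transv_rel X -> 2 < #|I| -> (exists c i j, i != j /\ X c i j != 1) ->
  sl2_card #|I| <= #|transv_group X| /\
  (#|transv_group X| = sl2_card #|I| -> forall i j, i != j ->
     X true i j = X false i j /\ X false i j ^+ 2 = 1).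
Proof.
move En: #|I| => n; elim: n I En gT X => // n IHn I En gT X relX I_ge3 [c [i [j
  [ij ntX]]]].
have I3 : 2 < #|I| by rewrite En.
have {c j ij}ntX : forall c i j, i != j -> X c i j != 1.
  move=> c' k l kl; apply: contraNneq ntX => E.
  by apply/eqP/(transv_eq1 relX I3 kl E).
have step o : sl2_card #|I|.-1 <= #|transv_group (fun c (i j : {x : I | o != x})
  =>
      coset 'C_(transv_group X)(row_group X false o)%G (X c (val i) (val j)))|
        /\
  (#|transv_group (fun c (i j : {x : I | o != x}) =>
      coset 'C_(transv_group X)(row_group X false o)%G (X c (val i) (val j)))|
      = sl2_card #|I|.-1 -> forall j, o != j -> X false o j ^+ 2 = 1).
  have other k : o != k -> exists j k' : {x : I | o != x}, j != k' /\ val k' =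
    k.
    move=> ok; have [j /andP[jk jo]] := ex_third I3 k o; rewrite eq_sym in jo.
    by exists (exist _ j jo), (exist _ k ok).
  have [k0 /andP[k0o _]] := ex_third I3 o o; rewrite eq_sym in k0o.
  have [j0 [k0' [jk0 _]]] := other k0 k0o.
  (* The quotient has rank [n], one less than [I]; the bound required in rank 2 is [sl2_card 2],
     that is 6. *)
  have [n2|n2] := eqVneq n 2.
    have [le6 eq6] := rank2_quotient relX ntX jk0.
    rewrite En n2; split=> // E k /other[j [k' [jk <-]]].
    by have [_ ->] := rank2_quotient relX ntX jk.
  have [|||le eq] := IHn {x : I | o != x} _ _ _ (transv_rel_quotient relX o).
  - by rewrite card_quotient_index En.
  - by rewrite ltn_neqAle eq_sym n2 -ltnS.
  - by exists false, j0, k0'; split=> //; apply: ntX_quotient.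
  rewrite En /=; split=> // E k /other[j [k' [jk <-]]].
  have [_] := eq E _ _ jk; move/eqP; rewrite quotient_exp // => /eqP //.
split; first by have [le eq] := step i; have [] := step_bound relX I3 ntX le eq;
  rewrite En.
move=> E {}i k ik; have [le eq] := step i.
by have [_] := step_bound relX I3 ntX le eq; rewrite En; apply.
Qed.

(** * The equality case *)

Definition toggle (I : finType) (k : I) (S : {set I}) :=
  if k \in S then S :\ k else k |: S.

(** [S] is the support of a row vector over Z/2, on which the transvection adds the coordinate [l]
    to the coordinate [k]. *)
Definition dual_act (I : finType) (k l : I) (S : {set I}) :=
  if l \in S then toggle k S else S.

Lemma in_dual_act (I : finType) (k l i : I) (S : {set I}) :
  (i \in dual_act k l S) = (i \in S) (+) ((i == k) && (l \in S)).
Proof.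
rewrite /dual_act /toggle; case: ifP => _; last by rewrite andbF addbF.
rewrite andbT; case: ifP => kS; rewrite !inE; have [->|] := eqVneq i k;
  by rewrite ?kS //= ?addbF.
Qed.

Lemma dual_act_neq0 (I : finType) (k l : I) (S : {set I}) :
  k != l -> S != set0 -> dual_act k l S != set0.
Proof.
move=> kl S0; have [lS|lS] := boolP (l \in S); last by rewrite /dual_act (negPf
  lS).
by apply/set0Pn; exists l; rewrite in_dual_act lS eq_sym (negPf kl).
Qed.

Section ModTwoAction.

Variables (I : finType) (gT : finGroupType) (X : bool -> I -> I -> gT).
Hypotheses (relX : transv_rel X) (I_ge3 : 2 < #|I|).
Hypothesis ntX : forall c i j, i != j -> X c i j != 1.
Hypothesis eqX : forall i j, i != j -> X true i j = X false i j.
Hypothesis sqX : forall i j, i != j -> X false i j ^+ 2 = 1.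

Local Notation x := (X false).
Local Notation Q := (row_grp X false).

Let xV i j : i != j -> (x i j)^-1 = x i j.
Proof. by move=> ij; apply/eqP; rewrite eq_invg_mul -expg2 sqX. Qed.

Let xx i j : i != j -> x i j * x i j = 1.
Proof. by move=> ij; rewrite -{1}xV // mulVg. Qed.

Let s1 i j k : i != j -> i != k -> j != k -> x i j ^ x j k = x i j * x i k.
Proof. by case: relX => r1 _ _ _ ij ik jk; rewrite r1 // xV. Qed.

Let s2 i j k l : i != j -> k != l -> i != l -> j != k -> commute (x i j) (x k
  l).
Proof.
case: relX => _ _ r3 r4 ij kl il jk; have [<-|ik] := eqVneq i k.
  by have := r4 i j l ij il; rewrite eqX.
exact: r3.
Qed.

Let s2J i j k l : i != j -> k != l -> i != l -> j != k -> x i j ^ x k l = x i j.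
Proof. by move=> ij kl il jk; apply/conjg_fixP/commgP; apply: s2. Qed.

Let s3 i j k : i != j -> i != k -> j != k -> x j k ^ x i j = x j k * x i k.
Proof.
move=> ij ik jk; rewrite -[in RHS](xV ik) -[in RHS](mulKg (x i j) (x i k)) -s1
  //.
by rewrite /conjg !invMg !invgK !mulgA mulgV mul1g.
Qed.

Let neq_sym (i j : I) : i != j -> j != i. Proof. by rewrite eq_sym. Qed.

(** The braid relation of SL(2, 2), obtained with a third index: the word [w] moves [x m k] to
    [x l k] and [x k l] to [x k m], hence their commutator [x m l] to [x l m]. *)
Lemma transv_braid l m : l != m -> x m l ^ x l m = x l m ^ x m l.
Proof.
move=> lm; have [k /andP[kl km]] := ex_third I_ge3 l m.
have [ml lk mk] := And3 (neq_sym lm) (neq_sym kl) (neq_sym km).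
pose w := x l m * x m l * x l m.
have w1 : x m k ^ w = x l k.
  by rewrite !conjgM s3 // (conjMg (x m k)) s2J // s3 // (s2 lk mk) // mulgA xx
    // mul1g s2J.
have w2 : x k l ^ w = x k m.
  by rewrite !conjgM s1 // (conjMg (x k l)) s2J // s1 // mulgA -(s2 km kl) //
    -mulgA xx // mulg1 s2J.
have xml : x m l = x m k * x m k ^ x k l by rewrite s1 // mulgA xx // mul1g.
have w3 : x m l ^ w = x l m.
  by rewrite xml conjMg conjJg w1 w2 s1 // mulgA xx // mul1g.
have : x m l * w = w * x l m by rewrite -w3 -conjgC.
rewrite /w -!mulgA xx // mulg1 => /(congr1 (fun z => z * x l m)).
rewrite -!mulgA xx // mulg1 => E.
by rewrite /conjg !xV.
Qed.

(** Both sides belong to the row vector with support {l, m}. This is the smallest instance of the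
    independence proved in [point_base]. *)
Lemma row_conj_swap l m : l != m -> Q m :^ x l m = Q l :^ x m l.
Proof.
suff sub l' m' : l' != m' -> Q m' :^ x l' m' \subset Q l' :^ x m' l'.
  by move=> lm; apply/eqP; rewrite eqEsubset !sub // eq_sym.
move=> {l m}lm; have ml := neq_sym lm; move: l' m' lm ml => l m lm ml.
rewrite -genJ gen_subG; apply/subsetP => _ /imsetP[_ /imsetP[j + ->] ->].
rewrite inE => mj; have [->|jl] := eqVneq j l.
  by rewrite transv_braid // memJ_conjg row_in.
have lj := neq_sym jl; have jm := neq_sym mj; rewrite s3 // -(s2 lj mj) // -s3
  //.
by rewrite memJ_conjg row_in.
Qed.

Let u m s := \prod_(j <- s) x j m.

Let uV m s : m \notin s -> (u m s)^-1 = u m (rev s).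
Proof.
elim: s => [|j s IHs]; first by rewrite /u !big_nil invg1.
rewrite in_cons negb_or => /andP[mj ms]; have jm := neq_sym mj.
by rewrite /u big_cons invMg xV // -/(u m s) IHs // rev_cons -cats1 big_cat
  big_seq1.
Qed.

Let u_comm m k l s : m \notin s -> l \notin s -> k != m -> k != l ->
  commute (u m s) (x k l).
Proof.
move=> ms ls km kl; rewrite /u big_seq; apply: commute_sym.
elim/big_ind: _ => [|a b|j js]; [exact: commute1 | exact: commuteM |].
by apply: s2 => //; [apply: contraNneq ms => <- | apply: contraNneq ls => ->].
Qed.

Let toggle_prod m (T : {set I}) k r : uniq r -> m \notin T -> k != m -> k \notin
  T ->
  \prod_(j <- r | j \in k |: T) x j m =
  \prod_(j <- r | j \in T) x j m * (if k \in r then x k m else 1).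
Proof.
move=> + mT km kT; elim: r => [|a r IHr] /=; first by rewrite !big_nil mulg1.
case/andP=> ar ur; rewrite !big_cons !inE.
have [Eak|ak] := eqVneq a k; last first.
  by rewrite /= IHr //; case: ifP => _; rewrite ?mulgA.
subst a; rewrite (negPf kT) /=.
have -> : \prod_(j <- r | j \in k |: T) x j m = \prod_(j <- r | j \in T) x j m.
  rewrite big_seq_cond [RHS]big_seq_cond; apply: eq_bigl => j.
  by rewrite !inE; have [->|] := eqVneq j k; rewrite ?(negPf ar).
elim/big_ind: _ => [|a b|j Tj]; [exact: commute1 | exact: commuteM |].
have jm : j != m by apply: contraNneq mT => <-.
by apply: s2; rewrite // neq_sym.
Qed.

(** Enumerating all of [I] makes the product a function of the set. Its factors are commuting
    involutions, so toggling an index amounts to one multiplication. *)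
Let mult m (T : {set I}) := \prod_(j <- enum I | j \in T) x j m.

Let mult_toggle m (T : {set I}) k : m \notin T -> k != m -> mult m (toggle k T)
  = mult m T * x k m.
Proof.
have ins (T' : {set I}) : m \notin T' -> k != m -> k \notin T' ->
    mult m (k |: T') = mult m T' * x k m.
  by move=> mT km kT; rewrite /mult toggle_prod ?enum_uniq // mem_enum.
move=> mT km; rewrite /toggle; case: ifP => kT; last by rewrite ins ?kT.
rewrite -[in RHS](setD1K kT) ins ?setD11 //; first by rewrite -mulgA xx //
  mulg1.
by rewrite !inE negb_and mT orbT.
Qed.

Let multE m (T : {set I}) : m \notin T -> exists s,
  [/\ mult m T = u m s, uniq s & forall j, j \in s -> j \in T].
Proof.
move=> mT; exists [seq j <- enum I | j \in T]; rewrite /u big_filter filter_uniq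
  ?enum_uniq //.
by split=> // j; rewrite mem_filter => /andP[].
Qed.

Let point m (S : {set I}) : {set gT} := Q m :^ mult m (S :\ m).

Let point_norm k l m (S : {set I}) : m \in S -> l \notin S -> k != l ->
  point m S :^ x k l = point m S.
Proof.
move=> mS lS kl; have ml : m != l by apply: contraNneq lS => <-.
have mS' : m \notin S :\ m by rewrite setD11.
have [s [Es us sS]] := multE mS'; rewrite /point Es -conjsgM.
have ms : m \notin s by apply/negP => /sS; rewrite setD11.
have ls : l \notin s by apply/negP => /sS/setD1P[_]; apply/negP.
suff /normP NQ : x k l ^ (u m s)^-1 \in 'N(Q m).
  by rewrite -[RHS](congr1 (fun A => A :^ u m s) NQ) -conjsgM -conjgCV.
have [->|km] := eqVneq k m.
  by rewrite uV //; apply: conj_u_row; rewrite ?mem_rev ?rev_uniq.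
rewrite (_ : _ ^ _ = x k l); first by apply: (row_norm relX);
  rewrite // neq_sym.
by apply/conjg_fixP/commgP/commuteV/commute_sym/u_comm.
Qed.

Let point_toggle k m (S : {set I}) : m \in S -> k != m ->
  point m S :^ x k m = point m (toggle k S).
Proof.
move=> mS km; rewrite /point -conjsgM -mult_toggle ?setD11 //;
  congr (_ :^ mult _ _).
apply/setP => i; rewrite /toggle !inE km /=; case: ifP => kS; rewrite !inE;
  by have [->|] := eqVneq i k; rewrite ?km ?andbT ?andbF ?orbT.
Qed.

Let row_swap_prod l m s : l != m -> l \notin s -> m \notin s ->
  Q m :^ (x l m * u m s) = Q l :^ (x m l * u l s).
Proof.
move=> lm; have ml := neq_sym lm; rewrite !conjsgM (row_conj_swap lm).
elim: s => [|j s IHs]; first by rewrite /u !big_nil !conjsg1.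
rewrite !in_cons !negb_or => /andP[lj ls] /andP[mj ms].
have [jl jm] := (neq_sym lj, neq_sym mj).
rewrite /u !big_cons -/(u m s) -/(u l s).
(* [x j l] normalises [Q m], and moving it past [x l m] turns it into [x j l * x j m]; hence [x j l]
   and [x j m] have the same effect on this conjugate. *)
have -> : (Q l :^ x m l) :^ (x j m * u m s) = (Q l :^ x m l) :^ (x j l * u m s).
  rewrite !conjsgM; congr (_ :^ u m s).
  have /normP NQ : x j l \in 'N(Q m) by apply: (row_norm relX).
  rewrite -(row_conj_swap lm) -{2}NQ -!conjsgM; congr (_ :^ _).
  by rewrite (mulgA (x j l)) (conjgC (x j l)) s1 // -!mulgA (s2 jm jl) // (mulgA
    (x j l)) xx // mul1g.
rewrite -(u_comm ms ls jm jl) [LHS]conjsgM IHs // -conjsgM.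
by rewrite (u_comm ls ls jl jl) -conjsgM.
Qed.

Let point_base l m (S : {set I}) : l \in S -> m \in S -> point l S = point m S.
Proof.
have [->//|lm lS mS] := eqVneq l m; have ml := neq_sym lm.
have E (i j : I) : i != j -> i \in S -> j \in S -> S :\ j = toggle i (S :\ j :\
  i).
  by move=> ij iS jS; rewrite /toggle setD11 setD1K // !inE ij.
set T := S :\ m :\ l; have C : S :\ l :\ m = T by apply/setP => i;
  rewrite !inE andbCA.
have mT : m \notin T by rewrite !inE eqxx andbF.
have lT : l \notin T by rewrite !inE eqxx.
rewrite /point (E l m) // (E m l) // C -/T !mult_toggle //.
pose s := [seq j <- enum I | j \in T].
have Es i : mult i T = u i s by rewrite /u big_filter.
have sT j : j \in s -> j \in T by rewrite mem_filter => /andP[].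
have ms : m \notin s by apply: contra mT => /sT.
have ls : l \notin s by apply: contra lT => /sT.
by rewrite !Es !u_comm // (row_swap_prod lm ls ms).
Qed.

(* The conjugate of the row group attached to the row vector with support S. *)
Definition mod2_point (S : {set I}) : {set gT} :=
  if [pick m in S] is Some m then point m S else set0.

Let mod2_pointE m (S : {set I}) : m \in S -> mod2_point S = point m S.
Proof.
move=> mS; rewrite /mod2_point; case: pickP => [l /= lS|/(_ m)];
  last by rewrite mS.
exact: point_base.
Qed.

Lemma mod2_point_act k l S : k != l -> S != set0 ->
  mod2_point S :^ x k l = mod2_point (dual_act k l S).
Proof.
move=> kl /set0Pn[m mS]; rewrite /dual_act; case: ifPn => lS.
  rewrite (mod2_pointE lS) point_toggle // (@mod2_pointE l) //.
  by rewrite /toggle; case: ifP => _; rewrite !inE lS ?andbT ?orbT // eq_sym.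
by rewrite (mod2_pointE mS) point_norm.
Qed.

Let mod2_points := mod2_point @: [set S | S != set0].

Let mod2_points_act g A : g \in transv_grp X -> A \in mod2_points -> A :^ g \in
  mod2_points.
Proof.
have G0 : group_set [set g | [forall A in mod2_points, A :^ g \in mod2_points]].
  apply/group_setP; split=> [|a b].
    by rewrite inE; apply/forall_inP => B BP; rewrite conjsg1.
  rewrite !inE => /forall_inP Pa /forall_inP Pb; apply/forall_inP => B BP.
  by rewrite conjsgM Pb // Pa.
suff /subsetP sub : transv_group X \subset Group G0.
  by move=> /sub; rewrite inE => /forall_inP; apply.
apply: transv_grp_sub => c i j ij; have -> : X c i j = x i j by case: c;
  rewrite ?eqX.
rewrite inE; apply/forall_inP => _ /imsetP[S + ->]; rewrite inE => S0.
by rewrite mod2_point_act // imset_f // inE dual_act_neq0.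
Qed.

(** By counting: the points form a set stable under the group, so they include all conjugates of one
    row group, and [index_norm_row] gives at least as many conjugates as there are non-empty
    sets. *)
Lemma mod2_point_inj S T : S != set0 -> T != set0 -> mod2_point S = mod2_point T
  ->
  S = T.
Proof.
move=> S0 T0; suff /imset_injP inj : #|mod2_points| == #|[set S : {set I} | S !=
  set0]|.
  by apply: inj; rewrite inE.
rewrite eqn_leq leq_imset_card /=.
case/set0Pn: S0 => o _ {T T0}.
have -> : #|[set S : {set I} | S != set0]| = (2 ^ #|I|).-1.
  have := cardsD1 set0 (powerset [set: I]).
  rewrite card_powerset cardsT inE sub0set add1n => ->.
  by apply: eq_card => A; rewrite !inE subsetT andbT.
apply: leq_trans (index_norm_row relX I_ge3 ntX o) _.
rewrite -card_conjugates; apply/subset_leq_card/subsetP => _ /imsetP[g Kg ->].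
apply: mod2_points_act => //; apply/imsetP; exists [set o].
  by rewrite inE; apply/set0Pn; exists o; rewrite inE.
rewrite (mod2_pointE (set11 o)) /point setDv /mult big_pred0 ?conjsg1 // => i.
by rewrite inE.
Qed.

End ModTwoAction.

(** * Transvections of the free group *)

(** The subgroup generated by the transvections, as a set of words, because here the group may be
    infinite. *)
Inductive transv_gen (I : finType) (G : groupType) (X : bool -> I -> I -> G)
  : G -> Prop :=
| transv_gen1 : transv_gen X 1
| transv_genM g c i j : transv_gen X g -> i != j -> transv_gen X (g * X c i j)
| transv_genV g c i j : transv_gen X g -> i != j -> transv_gen X (g * (X c i
  j)^-1).

Lemma transv_gen_mul (I : finType) (G : groupType) (X : bool -> I -> I -> G) g
  h :
  transv_gen X g -> transv_gen X h -> transv_gen X (g * h).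
Proof.
move=> Xg; elim=> [|k c i j _ IHk ij|k c i j _ IHk ij]; rewrite ?mulg1 // mulgA.
  exact: transv_genM.
exact: transv_genV.
Qed.

Lemma transv_gen_in (I : finType) (G : groupType) (X : bool -> I -> I -> G) c i
  j :
  i != j -> transv_gen X (X c i j).
Proof. by move=> ij; rewrite -[X c i j]mul1g; apply: transv_genM;
  [exact: transv_gen1 |]. Qed.

Lemma transv_gen_inV (I : finType) (G : groupType) (X : bool -> I -> I -> G) c i
  j :
  i != j -> transv_gen X (X c i j)^-1.
Proof. by move=> ij; rewrite -[_^-1]mul1g; apply: transv_genV;
  [exact: transv_gen1 |]. Qed.

Lemma transv_gen_inv (I : finType) (G : groupType) (X : bool -> I -> I -> G) g :
  transv_gen X g -> transv_gen X g^-1.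
Proof.
elim=> [|k c i j _ IHk ij|k c i j _ IHk ij]; rewrite ?invg1 ?invMg ?invgK.
- exact: transv_gen1.
- by apply: transv_gen_mul IHk; apply: transv_gen_inV.
by apply: transv_gen_mul IHk; apply: transv_gen_in.
Qed.

Section FreeGroupTransvections.

Variable n : nat.
Local Notation F := (free_group n).
Local Notation x := (@fg_gen n).

(** The default value is the identity; [aut_ofE] shows that it does not occur once an inverse is
    exhibited. *)
Definition aut_of (f : 'I_n -> F) : autg F := insubd (1 : autg F) (fg_lift f).

Lemma aut_ofE (f g : 'I_n -> F) :
    (forall i, fg_lift f (g i) = x i) -> (forall i, fg_lift g (f i) = x i) ->
  aut_of f =1 fg_lift f.
Proof.
move=> fg gf u; rewrite /aut_of insubdK //; apply/asboolP; split;
  last exact: gmulfM.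
exists (fg_lift g) => v.
  move: v; apply: (@fg_hom_ext _ _ (fg_lift g \o fg_lift f) idfun) => i /=.
  by rewrite fg_lift_gen.
move: v; apply: (@fg_hom_ext _ _ (fg_lift f \o fg_lift g) idfun) => i /=.
by rewrite fg_lift_gen.
Qed.

Lemma aut_ext (f g : autg F) : (forall i, f (x i) = g (x i)) -> f = g.
Proof. by move=> fg; apply/autg_ext/(@fg_hom_ext _ _ f g). Qed.

Definition aut_transv (c : bool) (i j : 'I_n) : autg F :=
  aut_of (fun k => if k == i then if c then (x j)^-1 * x i else x i * x j else x
    k).

Definition aut_flip (o : 'I_n) : autg F :=
  aut_of (fun k => if k == o then (x o)^-1 else x k).

Lemma aut_flip_gen o k : aut_flip o (x k) = if k == o then (x o)^-1 else x k.
Proof.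
set f := fun k => if k == o then (x o)^-1 else x k.
have ff i : fg_lift f (f i) = x i.
  rewrite [f i]/f; case: (eqVneq i o) => [->|io]; last by rewrite fg_lift_gen /f
    (negPf io).
  by rewrite gmulfV /= fg_lift_gen /f eqxx invgK.
by rewrite /aut_flip (aut_ofE ff ff) fg_lift_gen.
Qed.

Lemma aut_transv_gen c i j k : i != j ->
  aut_transv c i j (x k) =
    if k == i then if c then (x j)^-1 * x i else x i * x j else x k.
Proof.
move=> ij; pose f k := if k == i then if c then (x j)^-1 * x i else x i * x j
  else x k.
pose g k := if k == i then if c then x j * x i else x i * (x j)^-1 else x k.
have ji : (j == i) = false by rewrite eq_sym (negPf ij).
have fg m : fg_lift f (g m) = x m.
  rewrite /g; case: (eqVneq m i) => [->|mi]; last by rewrite fg_lift_gen /f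
    (negPf mi).
  rewrite fun_if !gmulfM !gmulfV /= !fg_lift_gen /f eqxx ji.
  by case: (c); rewrite ?mulKVg ?mulgK.
have gf m : fg_lift g (f m) = x m.
  rewrite /f; case: (eqVneq m i) => [->|mi]; last by rewrite fg_lift_gen /g
    (negPf mi).
  rewrite fun_if !gmulfM !gmulfV /= !fg_lift_gen /g eqxx ji.
  by case: (c); rewrite ?mulKg ?mulgVK.
by rewrite /aut_transv (aut_ofE fg gf) fg_lift_gen.
Qed.

Lemma aut_transvV_gen c i j k : i != j ->
  (aut_transv c i j)^-1 (x k) =
    if k == i then if c then x j * x i else x i * (x j)^-1 else x k.
Proof.
move=> ij; apply: (@autg_inj _ (aut_transv c i j)).
rewrite -[LHS]/((aut_transv c i j * (aut_transv c i j)^-1) (x k)) mulgV.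
rewrite -[LHS]/(x k); have [->|ki] := eqVneq k i; last first.
  by rewrite aut_transv_gen // (negPf ki).
by case: c; rewrite gmulfM ?gmulfV /= !aut_transv_gen // eqxx eq_sym (negPf ij)
  ?mulKVg // mulgK.
Qed.

Lemma autgME (f g : autg F) u : (f * g) u = f (g u). Proof. by []. Qed.

Lemma aut_transv_rel : transv_rel aut_transv.
Proof.
have nsym (i j : 'I_n) : i != j -> (j == i) = false by rewrite eq_sym => /negPf.
have conjE (a b c d : autg F) : a * b * d = b * c -> a ^ b = c * d^-1.
  by move=> E; apply: (mulgI b); rewrite -conjgC mulgA -E mulgK.
split.
- move=> c i j k ij ik jk; apply: conjE; apply: aut_ext => m; rewrite !autgME.
  have E := (eqxx, negPf ij, negPf ik, negPf jk, nsym _ _ ij, nsym _ _ ik, nsym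
    _ _ jk).
  have [->|mi] := eqVneq m i; [|have [->|mj] := eqVneq m j];
    case: c; do ?[rewrite ?gmulfM ?gmulfV ?aut_transv_gen ?E ?(negPf mi) ?(negPf
      mj) //=];
    by rewrite ?invMg ?mulgA ?mulVg ?mulgV ?mul1g ?mulgVK ?mulgK.
- move=> c i j k ij ik jk; rewrite -[RHS]mulg1 -invg1; apply: conjE;
    rewrite mulg1.
  apply: aut_ext => m; rewrite !autgME.
  have E := (eqxx, negPf ij, negPf ik, negPf jk, nsym _ _ ij, nsym _ _ ik, nsym
    _ _ jk).
  have [->|mi] := eqVneq m i; [|have [->|mj] := eqVneq m j];
    case: c; do ?[rewrite ?gmulfM ?gmulfV ?aut_transv_gen ?E ?(negPf mi) ?(negPf
      mj) //=];
    by rewrite ?invMg ?invgK ?mulgA ?mulVg ?mulgV ?mul1g ?mulgVK ?mulgK.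
- move=> b c i j k l ij kl ik il jk; apply: aut_ext => m; rewrite !autgME.
  have E := (eqxx, negPf ij, negPf kl, negPf ik, negPf il, negPf jk,
             nsym _ _ ij, nsym _ _ kl, nsym _ _ ik, nsym _ _ il, nsym _ _ jk).
  have [->|mi] := eqVneq m i; [|have [->|mk] := eqVneq m k];
    case: b; case: c; do ?[rewrite ?gmulfM ?gmulfV ?aut_transv_gen ?E ?(negPf
      mi) ?(negPf mk) //=].
move=> i j k ij ik; apply: aut_ext => m; rewrite !autgME.
have E := (eqxx, negPf ij, negPf ik, nsym _ _ ij, nsym _ _ ik).
have [->|mi] := eqVneq m i;
  do ?[rewrite ?gmulfM ?gmulfV ?aut_transv_gen ?E ?(negPf mi) //=].
by rewrite mulgA.
Qed.

End FreeGroupTransvections.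

(** * Nielsen's theorem *)

(** The domain and the range of a partial injection have complements of equal size, which are
    matched in the order of their enumerations. *)
Lemma extend_partial_perm (T : finType) (R : rel T) :
  (forall w a b, R w a -> R w b -> a = b) ->
  (forall w a b, R a w -> R b w -> a = b) ->
  exists s : {perm T}, forall a b, R a b -> s a = b.
Proof.
move=> Rfun Rinj; pose A := [set a | [exists b, R a b]].
pose d a := odflt a [pick b | R a b].
have dE a b : R a b -> d a = b.
  move=> Rab; rewrite /d; case: pickP => [c Rac|/(_ b)]; last by rewrite Rab.
  exact: Rfun Rac Rab.
have dA a : a \in A -> R a (d a).
  by rewrite inE => /existsP[b Rab]; rewrite (dE a b).
have d_inj : {in A &, injective d}.
  by move=> a b /dA Ra /dA Rb Eab; apply: Rinj Ra _; rewrite Eab.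
pose B := d @: A.
have cardB : #|B| = #|A| by rewrite card_in_imset.
have EAB : size (enum (~: A)) = size (enum (~: B)).
  by rewrite -!cardE; apply/eqP; rewrite -(eqn_add2l #|A|) -{2}cardB !cardsC.
pose g a := if a \in A then d a else nth a (enum (~: B)) (index a (enum (~:
  A))).
have ltA a : a \notin A -> index a (enum (~: A)) < size (enum (~: B)).
  by move=> Aa; rewrite -EAB index_mem mem_enum in_setC.
have gB a : (g a \in B) = (a \in A).
  rewrite /g; case: ifP => [Aa|/negbT Aa]; first by rewrite imset_f.
  by have := mem_nth a (ltA a Aa); rewrite mem_enum in_setC => /negPf.
have g_inj : injective g.
  move=> a b Eab; have := gB a; rewrite Eab gB => AE; move: Eab; rewrite /g -AE.
  case: ifP => [Ab|/negbT Ab]; first by apply: d_inj; rewrite -?AE.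
  rewrite (set_nth_default b a) ?ltA -?AE // => /eqP.
  rewrite nth_uniq ?enum_uniq ?ltA -?AE // => /eqP Ei.
  rewrite -(nth_index a (s := enum (~: A)) (x := a)) ?mem_enum ?in_setC -?AE //
    Ei.
  by rewrite nth_index // mem_enum in_setC.
exists (perm g_inj) => a b Rab; rewrite permE /g inE.
by case: existsP => [_|[]]; [apply: dE | exists b].
Qed.

Section Nielsen.

Variable n : nat.
Local Notation F := (free_group n).
Local Notation x := (@fg_gen n).
Local Notation T := (@aut_transv n).
Local Notation gen := (transv_gen T).

Definition lval (a : letter n) : F := letter_val x a.

Lemma lval_linv a : lval (linv a) = (lval a)^-1.
Proof. by case: a => i []; rewrite /lval /letter_val /= ?invgK. Qed.

(* Vertex sets of finite subtrees of the Cayley graph containing 1, grown one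
   edge at a time. *)
Inductive tree : seq F -> Prop :=
| tree_root : tree [:: 1]
| tree_add P p a : tree P -> p \in P -> tree (p * lval a :: P).

Lemma tree_one P : tree P -> 1 \in P.
Proof. by elim=> [|Q p a _ Q1 _]; rewrite ?inE // Q1 orbT. Qed.

(** [u] is read along a loop at the root that runs in the tree to [p], crosses one edge labelled [a]
    to [q], and returns in the tree. *)
Definition spans (P : seq F) (u : F) :=
  exists p q a, [/\ p \in P, q \in P & u = p * lval a * q^-1].

Lemma spansV P u : spans P u -> spans P u^-1.
Proof.
move=> [p [q [a [Pp Pq ->]]]]; exists q, p, (linv a); split=> //.
by rewrite !invMg invgK lval_linv mulgA.
Qed.

Lemma spans_sub P Q u : {subset P <= Q} -> spans P u -> spans Q u.
Proof.
by move=> PQ [p [q [a [Pp Pq ->]]]]; exists p, q, a; split; rewrite ?PQ.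
Qed.

(* Identifying the vertices y and z translates by v the part of the tree where s
   holds; the edge above one of them becomes a chord reading v. *)
Lemma tree_fold P y z : tree P -> y \in P -> z \in P -> y != z ->
  exists v (s : F -> bool) P',
    [/\ v = y * z^-1 \/ v = z * y^-1, tree P', size P' < size P,
        {in P, forall p, (if s p then v * p else p) \in P'} & spans P' v].
Proof.
move=> tP; elim: tP y z => [|Q p a tQ IHQ Qp] y z.
  by rewrite !inE => /eqP-> /eqP->; rewrite eqxx.
rewrite !in_cons => yP zP yz.
have [Qpa|Qpa] := boolP (p * lval a \in Q).
  have toQ w : (w == p * lval a) || (w \in Q) -> w \in Q.
    by case/orP=> [/eqP->|].
  have [v [s [P' [vE tP' szP' sP' vP']]]] := IHQ y z (toQ y yP) (toQ z zP) yz.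
  exists v, s, P'; split=> //; first exact: leqW.
  by move=> w; rewrite inE => /toQ/sP'.
have fresh w : w \in Q -> (w == p * lval a) = false.
  by move=> Qw; apply: contraNF Qpa => /eqP <-.
have close w : w \in Q -> exists v (s : F -> bool) P',
    [/\ v = w * (p * lval a)^-1, tree P', size P' < (size Q).+1,
        {in p * lval a :: Q, forall t, (if s t then v * t else t) \in P'} &
          spans P' v].
  move=> Qw; exists (w * (p * lval a)^-1), (pred1 (p * lval a)), Q; split=> //.
    move=> t; rewrite inE /=; case: eqP => [->|_ //].
    by rewrite mulgVK.
  by exists w, p, (linv a); rewrite lval_linv invMg mulgA.
case/predU1P: yP => [Ey|Qy].
  case/predU1P: zP => [Ez|Qz]; first by rewrite Ey Ez eqxx in yz.
  by have [v [s [P' [vE ? ? ? ?]]]] := close z Qz; exists v, s, P'; split=> //;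
    right; rewrite Ey.
case/predU1P: zP => [Ez|Qz].
  by have [v [s [P' [vE ? ? ? ?]]]] := close y Qy; exists v, s, P'; split=> //;
    left; rewrite Ez.
have [v [s [P' [vE tP' szP' sP' vP']]]] := IHQ y z Qy Qz yz.
pose p' := if s p then v * p else p.
(* The leaf [p * lval a] follows its parent [p], so that the edge between them survives. *)
exists v, (fun t => if t == p * lval a then s p else s t), (p' * lval a :: P').
split=> //.
- by apply: tree_add => //; apply: sP'.
- move=> t; rewrite inE; case: eqP => [->|_] /= Qt.
    by rewrite inE /p'; case: (s p); rewrite -?mulgA eqxx.
  by rewrite inE sP' ?orbT.
by apply: spans_sub vP' => t; rewrite inE orbC => ->.
Qed.

Lemma left_move (f : autg F) m i v : m != i ->
    v = f (x i) \/ v = (f (x i))^-1 ->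
  exists2 e, gen e & forall k, (f * e) (x k) = if k == m then v * f (x m) else f
    (x k).
Proof.
move=> mi [] ->.
  exists (T true m i)^-1; first exact: transv_gen_inV.
  move=> k; rewrite autgME aut_transvV_gen //.
  by case: ifP => // _; rewrite gmulfM.
exists (T true m i); first exact: transv_gen_in.
move=> k; rewrite autgME aut_transv_gen //.
by case: ifP => // _; rewrite gmulfM gmulfV.
Qed.

Lemma right_move (f : autg F) m i v : m != i ->
    v = f (x i) \/ v = (f (x i))^-1 ->
  exists2 e, gen e & forall k, (f * e) (x k) = if k == m then f (x m) * v^-1
    else f (x k).
Proof.
move=> mi [] ->.
  exists (T false m i)^-1; first exact: transv_gen_inV.
  move=> k; rewrite autgME aut_transvV_gen //.
  by case: ifP => // _; rewrite gmulfM gmulfV.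
exists (T false m i); first exact: transv_gen_in.
move=> k; rewrite autgME aut_transv_gen // invgK.
by case: ifP => // _; rewrite gmulfM.
Qed.

(** Realises a fold by transvections: [a] and [b] mark the chords whose initial, respectively final,
    vertex is translated by [v]. The chord of [x i], which supplies [v], is left alone. *)
Lemma shift_move (f : autg F) i v (a b : 'I_n -> bool) :
    v = f (x i) \/ v = (f (x i))^-1 ->
  exists2 e, gen e & forall k, (f * e) (x k) =
    if k == i then f (x i) else
    (if a k then v else 1) * f (x k) * (if b k then v^-1 else 1).
Proof.
move=> vE; suff [e ge fe] : exists2 e, gen e & forall k, (f * e) (x k) =
    if (k == i) || (k \notin enum 'I_n) then f (x k) else
    (if a k then v else 1) * f (x k) * (if b k then v^-1 else 1).
  by exists e => // k; rewrite fe mem_enum orbF; case: eqP => [->|].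
elim: (enum _) (enum_uniq 'I_n) => [_|m r IHr /=/andP[mr ur]].
  by exists 1; [exact: transv_gen1 | move=> k; rewrite orbT mulg1].
have [e ge fe] := IHr ur; have [Emi|mi] := eqVneq m i.
  exists e => [//|k]; rewrite -autgME fe in_cons Emi negb_or.
  by case: (k == i).
have fei : (f * e) (x i) = f (x i) by rewrite fe eqxx.
have [e1 ge1 fe1] : exists2 e1, gen e1 & forall k, (f * e * e1) (x k) =
    if k == m then (if a m then v else 1) * (f * e) (x m) else (f * e) (x k).
  case: (a m); last first.
    exists 1; first exact: transv_gen1.
    by move=> k; rewrite mulg1 mul1g; case: eqP => [->|].
  by apply: (left_move mi); rewrite fei.
have fe1i : (f * e * e1) (x i) = f (x i) by rewrite fe1 eq_sym (negPf mi).
have [e2 ge2 fe2] : exists2 e2, gen e2 & forall k, (f * e * e1 * e2) (x k) =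
    if k == m then (f * e * e1) (x m) * (if b m then v^-1 else 1)
    else (f * e * e1) (x k).
  case: (b m); last first.
    exists 1; first exact: transv_gen1.
    by move=> k; rewrite !mulg1; case: eqP => [->|].
  by apply: (right_move mi); rewrite fe1i.
exists (e * e1 * e2); first by do !apply: transv_gen_mul.
move=> k; rewrite -?autgME !mulgA fe2 !fe1 !fe in_cons negb_or.
have [->|km] := eqVneq k m; first by rewrite eqxx mr (negPf mi) /=.
by rewrite /=.
Qed.

Definition supported (f : autg F) P := tree P /\ forall k, spans P (f (x k)).

(** The translation [v] of the fold is [f (x i)] up to inversion, so the other chords can follow it
    by transvections along [x i], and [x i] itself becomes the chord over the removed edge. *)
Lemma fold_step (f : autg F) P i y z : tree P -> y \in P -> z \in P -> y != z ->
    f (x i) = y * z^-1 -> (forall k, k != i -> spans P (f (x k))) ->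
  exists e P', [/\ gen e, size P' < size P & supported (f * e) P'].
Proof.
move=> tP Py Pz yz fi fP; have [v [s [P' [vE tP' szP' sP' vP']]]] := tree_fold
  tP Py Pz yz.
have {vE}vE : v = f (x i) \/ v = (f (x i))^-1.
  by case: vE => ->; [left | right]; rewrite fi // invMg invgK.
have /choice[t tE] k : exists t : F * F * letter n, k != i ->
    [/\ t.1.1 \in P, t.1.2 \in P & f (x k) = t.1.1 * lval t.2 * t.1.2^-1].
  have [->|ki] := eqVneq k i; first by exists (1, 1, (i, false)).
  by have [p [q [a ?]]] := fP k ki; exists (p, q, a).
have [e ge fe] := shift_move (fun k => s (t k).1.1) (fun k => s (t k).1.2) vE.
exists e, P'; split=> //; split=> // k; rewrite fe; case: eqVneq => [_|ki].
  by case: vE vP' => ->; rewrite // -{2}[f _]invgK; apply: spansV.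
have [tp tq ->] := tE k ki; exists (if s (t k).1.1 then v * (t k).1.1 else (t
  k).1.1).
exists (if s (t k).1.2 then v * (t k).1.2 else (t k).1.2), (t k).2.
split; rewrite ?sP' //.
by case: (s _); case: (s _); rewrite ?mul1g ?mulg1 ?invMg ?mulgA.
Qed.

Section Immersed.

Variables (f : autg F) (P : seq F) (st : 'I_n * bool -> F) (lab : 'I_n -> letter
  n).
Hypothesis tP : tree P.
Hypothesis stP : forall t, st t \in P.
Hypothesis fE : forall i, f (x i) = st (i, false) * lval (lab i) * (st (i,
  true))^-1.
Hypothesis no_fold :
  ~ exists e P', [/\ gen e, size P' < size P & supported (f * e) P'].

Let olab (t : 'I_n * bool) : letter n := if t.2 then linv (lab t.1) else lab
  t.1.
Let oval (t : 'I_n * bool) : F := if t.2 then (f (x t.1))^-1 else f (x t.1).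

Let ovalE t : oval t = st t * lval (olab t) * (st (t.1, ~~ t.2))^-1.
Proof.
case: t => i []; rewrite /oval /olab /= fE // !invMg invgK lval_linv.
by rewrite mulgA.
Qed.

Let fP k : spans P (f (x k)).
Proof. by exists (st (k, false)), (st (k, true)), (lab k); rewrite fE. Qed.

Let no_chord i y z : y \in P -> z \in P -> f (x i) = y * z^-1 -> y = z.
Proof.
move=> Py Pz fi; apply/eqP; apply/contraT => yz; case: no_fold.
exact: fold_step tP Py Pz yz fi _.
Qed.

Let no_ochord t y z : y \in P -> z \in P -> oval t = y * z^-1 -> y = z.
Proof.
case: t => i [] Py Pz; rewrite /oval /=; last exact: no_chord.
by move/(congr1 invg); rewrite invgK invMg invgK => /no_chord ->.
Qed.

(* The labelled graph: the edges of the tree together with one chord for every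
   f (x i). *)
Let edge (a : letter n) (w w' : F) := [/\ w \in P, w' \in P &
  w' = w * lval a \/ exists t, [/\ st t = w, olab t = a & st (t.1, ~~ t.2) =
    w']].

Let edge_sym a w w' : edge a w w' -> edge (linv a) w' w.
Proof.
case=> Pw Pw' [Ew|[t [tw ta tw']]]; split=> //.
  by left; rewrite Ew lval_linv mulgK.
right; exists (t.1, ~~ t.2); rewrite /= negbK -surjective_pairing; split=> //.
by rewrite -ta /olab; case: (t.2); rewrite //= linvK.
Qed.

(** Distinct targets would permit a fold. A chord parallel to a tree edge reads a quotient of two
    vertices at once; for chords of two generators one transvection achieves this first. *)
Let edge_fun a w w1 w2 : edge a w w1 -> edge a w w2 -> w1 = w2.
Proof.
case=> Pw Pw1 w1E [_ Pw2 w2E].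
have chord t b c : b \in P -> c \in P -> st t = w -> olab t = a ->
    st (t.1, ~~ t.2) = c -> b = w * lval a -> b = c.
  move=> Pb Pc tw ta tc Eb; apply: (no_ochord (t := t)) => //.
  by rewrite ovalE tw ta tc Eb.
case: w1E => [w1E|[t [tw ta tw1]]].
  case: w2E => [w2E|[t' [tw' ta' tw2']]]; first by rewrite w1E w2E.
  exact: chord tw' ta' tw2' w1E.
case: w2E => [w2E|[t' [tw' ta' tw2']]]; first by apply/esym;
  apply: chord tw ta tw1 w2E.
(* The two orientations of one chord carry a letter and its inverse, which are never equal. *)
have [Et|nt] := eqVneq t.1 t'.1.
  have [Es|ns] := eqVneq t.2 t'.2; first by rewrite -tw1 -tw2' Et Es.
  move: ta'; rewrite -ta /olab -Et; have -> : t'.2 = ~~ t.2.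
    by move: ns; case: (t.2); case: (t'.2).
  by case: (t.2) => /= /(congr1 snd) /=; case: (lab t.1).2.
apply/eqP; apply: contraT => w12; case: no_fold.
have Ev : (oval t)^-1 = f (x t.1) \/ (oval t)^-1 = (f (x t.1))^-1.
  by rewrite /oval; case: ifP => _; [left; rewrite invgK | right].
have nt' : t'.1 != t.1 by rewrite eq_sym.
have E12 : (oval t)^-1 * oval t' = w1 * w2^-1.
  rewrite !ovalE tw ta tw1 tw' ta' tw2' !invMg invgK -!mulgA; congr (_ * _).
  by rewrite !mulgA mulgVK mulVg mul1g.
have [e [g [ge [sE fe] keep]]] : exists e g, [/\ gen e,
    (g = w1 * w2^-1 \/ g = w2 * w1^-1) /\ (f * e) (x t'.1) = g &
    forall k, k != t'.1 -> (f * e) (x k) = f (x k)].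
  move: E12; rewrite {2}/oval; case: (t'.2) => E12.
    have [e ge fe] := right_move nt' Ev; exists e, (w2 * w1^-1); split=> //.
      split; first by right.
      by rewrite fe eqxx invgK; apply: invg_inj; rewrite invMg E12 invMg invgK.
    by move=> k kt; rewrite fe (negPf kt).
  have [e ge fe] := left_move nt' Ev; exists e, (w1 * w2^-1); split=> //.
    by split; [left | rewrite fe eqxx E12].
  by move=> k kt; rewrite fe (negPf kt).
have [y [z [Py Pz yz fy]]] : exists y z, [/\ y \in P, z \in P, y != z &
    (f * e) (x t'.1) = y * z^-1].
  case: sE fe => -> fe; first by exists w1, w2.
  by exists w2, w1; split=> //; rewrite eq_sym.
have [|e' [P' [ge' szP' sP']]] := fold_step tP Py Pz yz fy.
  by move=> k kt; rewrite keep.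
by exists (e * e'), P'; split; rewrite ?mulgA //; apply: transv_gen_mul.
Qed.

Let edge_perm : exists pi : 'I_n -> {perm seq_sub P},
  forall k a b, edge (k, false) (val a) (val b) -> pi k a = b.
Proof.
suff /choice[pi piE] : forall k, exists s : {perm seq_sub P},
  forall a b, edge (k, false) (val a) (val b) -> s a = b by exists pi.
move=> k.
have [|w a b /asboolP E1 /asboolP E2|s sE] :=
  @extend_partial_perm (seq_sub P) (fun a b => `[< edge (k, false) (val a) (val
    b) >]).
- by move=> w a b /asboolP E1 /asboolP E2; apply/val_inj/(edge_fun E1 E2).
- by apply/val_inj/(edge_fun (edge_sym E1) (edge_sym E2)).
by exists s => a b E; apply: sE; apply/asboolP.
Qed.

(* Edges with the same label have distinct sources and distinct targets, so the
   letters extend to permutations of P.  The f (x i) fix 1, hence so does the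
     whole free group. *)
Lemma immersed_trivial w : w \in P -> w = 1.
Proof.
have [pi piE] := edge_perm.
pose phi : F -> {perm seq_sub P} := fg_lift pi.
have phiM u v : phi (u * v) = phi u * phi v by apply: fg_lift_mul.
have phiV u : phi u^-1 = (phi u)^-1 by rewrite /phi gmulfV.
have phi_edge a b c : edge a (val b) (val c) -> phi (lval a) b = c.
  case: a => k [] E; rewrite /lval /letter_val /=;
    last by rewrite /phi fg_lift_gen; apply: piE.
  apply: (@perm_inj _ (phi (x k))); rewrite phiV -permM mulVg perm1.
  by rewrite /phi fg_lift_gen; apply/esym/piE; apply: (edge_sym E).
pose root : seq_sub P := SeqSub (tree_one tP).
have path Q : tree Q -> {subset Q <= P} -> forall p, p \in Q -> val (phi p root)
  = p.
  elim=> [|{}Q p a _ IHQ Qp] QP q.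
    by rewrite inE => /eqP->; rewrite /phi gmulf1 perm1.
  have QP' : {subset Q <= P} by move=> r Qr; apply: QP; rewrite inE Qr orbT.
  case/predU1P=> [->|]; last exact: IHQ.
  have Ppa : p * lval a \in P by apply: QP; apply: mem_head.
  rewrite phiM permM (phi_edge a _ (SeqSub Ppa)) //=.
  by split; rewrite ?IHQ // ?QP' //; left.
have phi_st t : phi (st t) root = SeqSub (stP t).
  by apply/val_inj; rewrite (path _ tP).
have phi_f i : phi (f (x i)) root = root.
  rewrite fE !phiM phiV !permM phi_st.
  rewrite (phi_edge _ _ (SeqSub (stP (i, true)))); last first.
    by split; rewrite ?stP //; right; exists (i, false).
  by rewrite -phi_st permK.
have phi_fix u : phi (f u) root = root.
  elim/fg_ind: u => [|i u IHu|i u IHu].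
  - by rewrite gmulf1 /phi gmulf1 perm1.
  - by rewrite gmulfM phiM permM phi_f.
  by rewrite gmulfM gmulfV phiM phiV permM -{1}(phi_f i) permK.
(* By surjectivity [w] is a value of [f], so it fixes the root; but its action carries the root to
   the vertex [w]. *)
move=> Pw; have := phi_fix (f^-1 w).
rewrite -[f _]/((f * f^-1) w) mulgV -[X in phi X]/w.
by move/(congr1 val); rewrite (path _ tP).
Qed.

End Immersed.

Lemma nielsen_letters m (f : autg F) P : size P < m -> supported f P ->
  exists2 e, gen e & exists a : 'I_n -> letter n, forall i, (f * e) (x i) = lval
    (a i).
Proof.
elim: m f P => // m IHm f P ltPm [tP sP].
have [[e [P' [ge szP' sP']]]|no_fold] := pselect
    (exists e P', [/\ gen e, size P' < size P & supported (f * e) P']).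
  have [|e' ge' [a fa]] := IHm _ P' _ sP'; first exact: leq_trans szP' _.
  exists (e * e'); first exact: transv_gen_mul.
  by exists a => i; rewrite mulgA.
have /choice[t tE] k : exists t : F * F * letter n,
    [/\ t.1.1 \in P, t.1.2 \in P & f (x k) = t.1.1 * lval t.2 * t.1.2^-1].
  by have [p [q [a ?]]] := sP k; exists (p, q, a).
pose st (u : 'I_n * bool) := if u.2 then (t u.1).1.2 else (t u.1).1.1.
have stP u : st u \in P by have [] := tE u.1; rewrite /st; case: (u.2).
have fE i : f (x i) = st (i, false) * lval (t i).2 * (st (i, true))^-1.
  by have [] := tE i.
have triv := immersed_trivial tP stP fE no_fold.
exists 1; first exact: transv_gen1.
by exists (fun i => (t i).2) => i; rewrite mulg1 fE !(triv _ (stP _)) mul1g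
  invg1 mulg1.
Qed.

End Nielsen.

(** * Supporting trees and signed permutations of the letters *)

Section Nielsen.

Variable n : nat.
Local Notation F := (free_group n).
Local Notation x := (@fg_gen n).
Local Notation T := (@aut_transv n).
Local Notation gen := (transv_gen T).
Local Notation lval := (@lval n).

Lemma tree_extend P p w : @tree n P -> p \in P ->
  exists P', [/\ tree P', {subset P <= P'} & p * w \in P'].
Proof.
elim/fg_ind: w P p => [|i u IHu|i u IHu] P p tP Pp.
- by exists P; split; rewrite ?mulg1.
- have [|P' [tP' sP' uP']] := IHu _ (p * lval (i, false)) (tree_add (i, false)
    tP Pp).
    exact: mem_head.
  exists P'; split=> [//|q Qq|]; first by apply: sP'; rewrite inE Qq orbT.
  by rewrite mulgA.
have [|P' [tP' sP' uP']] := IHu _ (p * lval (i, true)) (tree_add (i, true) tP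
  Pp).
  exact: mem_head.
exists P'; split=> [//|q Qq|]; first by apply: sP'; rewrite inE Qq orbT.
by rewrite mulgA.
Qed.

(** A tree through the elements [f (x k) * (x k)^-1] suffices, since an edge labelled [x k] from
    there to the root then reads [f (x k)]. *)
Lemma supported_ex (f : autg F) : exists P, supported f P.
Proof.
suff [P [tP PP]] : exists P, tree P /\ forall k, k \in enum 'I_n -> f (x k) * (x
  k)^-1 \in P.
  exists P; split=> // k; exists (f (x k) * (x k)^-1), 1, (k, false); split.
  - by rewrite PP ?mem_enum.
  - exact: tree_one.
  by rewrite invg1 mulg1 mulgVK.
elim: (enum _) => [|k r [P [tP rP]]]; first by exists [:: 1]; split=> //;
  exact: tree_root.
have [P' [tP' sP' kP']] := tree_extend (f (x k) * (x k)^-1) tP (tree_one tP).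
exists P'; split=> // m; rewrite in_cons => /predU1P[Em|mr]; last exact/sP'/rP.
by rewrite Em; rewrite mul1g in kP'.
Qed.

Lemma autgV (f : autg F) u : f u^-1 = (f u)^-1.
Proof. exact: gmulfV. Qed.

(** The quarter turn as a product of three elementary factors. A sign on one letter is unavoidable,
    and [flip_move], its square, changes signs in pairs; hence one undetermined sign remains at the
    end. *)
Lemma swap_move k i : k != i -> exists2 e, gen e & forall (f : autg F) m,
  (f * e) (x m) = if m == k then f (x i) else if m == i then (f (x k))^-1 else f
    (x m).
Proof.
move=> ki; have ik : i != k by rewrite eq_sym.
exists (T false k i * (T false i k)^-1 * (T true k i)^-1).
  do !apply: transv_gen_mul; first exact: transv_gen_in.
    exact: transv_gen_inV.
  exact: transv_gen_inV.
move=> f m; rewrite mulgA (mulgA f) 3!autgME aut_transvV_gen //.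
case: (eqVneq m k) => [_|mk].
  rewrite autgM !aut_transvV_gen //; rewrite eqxx (negPf ki) mulgVK.
  by rewrite aut_transv_gen // (negPf ik).
rewrite aut_transvV_gen //; case: (eqVneq m i) => [_|mi].
  rewrite autgM autgV !aut_transv_gen //; rewrite eqxx (negPf ik) invMg mulKVg.
  by rewrite autgV.
by rewrite aut_transv_gen // (negPf mk).
Qed.

Lemma flip_move k o : k != o -> exists2 e, gen e & forall (f : autg F) m,
  (f * e) (x m) = if (m == k) || (m == o) then (f (x m))^-1 else f (x m).
Proof.
move=> ko; have [e ge fe] := swap_move ko; exists (e * e);
  first exact: transv_gen_mul.
have ok : (o == k) = false by rewrite eq_sym (negPf ko).
move=> f m; rewrite mulgA !fe !eqxx ok; case: (eqVneq m k) => [->//|mk].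
by case: (eqVneq m o) => [->//|mo].
Qed.

Lemma letters_unpermute m (f : autg F) (a : 'I_n -> letter n) :
    (forall i, f (x i) = lval (a i)) -> #|[set i | (a i).1 != i]| <= m ->
  exists2 e, gen e & exists s, forall i, (f * e) (x i) = lval (i, s i).
Proof.
elim: m f a => [|m IHm] f a fa.
  rewrite leqn0 cards_eq0 => /eqP a0; exists 1; first exact: transv_gen1.
  exists (fun i => (a i).2) => i; rewrite mulg1 fa.
  suff Ei : (a i).1 == i by rewrite -{2}(eqP Ei) -surjective_pairing.
  by apply: contraT => ai; have := in_set0 i; rewrite -a0 inE ai.
have [a0|[k]] := set_0Vmem [set i | (a i).1 != i].
  by move=> _; apply: IHm fa _; rewrite a0 cards0.
(* Two generators sent to the same letter up to sign would themselves be equal or inverse, as [f] is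
   injective. *)
move=> ak; have a_inj : injective (fun i => (a i).1).
  move=> i j Eij; have [//|Es] : lval (a i) = lval (a j) \/ lval (a i) = (lval
    (a j))^-1.
    rewrite -lval_linv; case: (a i) (a j) Eij => [i' []] [j' []] /= -> ;
      by [left | right].
  by rewrite -!fa => /autg_inj/(congr1 (@fg_word n)) [].
  by move: Es; rewrite -!fa -gmulfV => /autg_inj/(congr1 (@fg_word n)).
have [i Ei] : exists i, (a i).1 = k.
  by have [g _ gK] := injF_bij a_inj; exists (g k).
have ki : k != i by apply: contraTneq ak => Eki; rewrite inE negbK {1}Eki Ei.
have [e ge fe] := swap_move ki => sz.
pose a' j := if j == k then a i else if j == i then linv (a k) else a j.
have [||e' ge' [s fs]] := IHm (f * e) a'.
- move=> j; rewrite fe /a'; case: ifP => // _; case: ifP => // _.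
  by rewrite lval_linv fa.
- rewrite -ltnS (leq_trans _ sz) // [X in _ < X](cardsD1 k) ak ltnS.
  apply/subset_leq_card/subsetP => j; rewrite !inE /a'.
  have [->|jk] := eqVneq j k; first by rewrite Ei eqxx.
  by have [->|ji] := eqVneq j i; rewrite // Ei ki.
by exists (e * e'); [exact: transv_gen_mul | exists s => j; rewrite mulgA].
Qed.

Lemma letters_unflip o m (f : autg F) (s : 'I_n -> bool) :
    (forall i, f (x i) = lval (i, s i)) -> #|[set i | (i != o) && s i]| <= m ->
  exists2 e, gen e & f * e = 1 \/ f * e = aut_flip o.
Proof.
elim: m f s => [|m IHm] f s fs.
  rewrite leqn0 cards_eq0 => /eqP s0; exists 1; first exact: transv_gen1.
  have sF i : i != o -> s i = false.
    by move=> io; apply/negP => si; have := in_set0 i; rewrite -s0 inE io si.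
  rewrite mulg1; case so: (s o); [right | left]; apply: aut_ext => i;
    rewrite fs.
    by rewrite aut_flip_gen; case: (eqVneq i o) => [->|io]; rewrite ?so ?sF.
  by case: (eqVneq i o) => [->|io]; rewrite ?so ?sF.
have [s0|[k]] := set_0Vmem [set i | (i != o) && s i].
  by move=> _; apply: IHm fs _; rewrite s0 cards0.
move=> sk sz; move: (sk); rewrite inE => /andP[ko sTk].
have [e ge fe] := flip_move ko.
have [||e' ge' fe'] := IHm (f * e) (fun i => if (i == k) || (i == o) then ~~ s i
  else s i).
- move=> j; rewrite fe fs; case: ifP => // _.
  by rewrite -lval_linv.
- rewrite -ltnS (leq_trans _ sz) // [X in _ < X](cardsD1 k) sk ltnS.
  apply/subset_leq_card/subsetP => j; rewrite !inE.
  have [->|jk] := eqVneq j k; first by rewrite sTk andbF.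
  by have [->|jo] := eqVneq j o.
by exists (e * e'); [exact: transv_gen_mul | rewrite mulgA].
Qed.

Theorem nielsen o (f : autg F) : exists2 e, gen e & f * e = 1 \/ f * e =
  aut_flip o.
Proof.
have [P sP] := supported_ex f.
have [e1 ge1 [a fa]] := nielsen_letters (ltnSn _) sP.
have [e2 ge2 [s fs]] := letters_unpermute fa (leqnn _).
have [e3 ge3 fe3] := letters_unflip fs (leqnn _) (o := o).
by exists (e1 * e2 * e3); [do !apply: transv_gen_mul | rewrite !mulgA].
Qed.

End Nielsen.

(** * Column reduction over the integers *)

Section IntegerMatrices.

Variable n : nat.
Implicit Types (A B : GL n int) (S : {set 'I_n}).

Definition GLZ_transv c i j : GL n int := aut_GL (aut_transv c i j).
Local Notation gen := (transv_gen GLZ_transv).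

Lemma GLZ_transvE c i j l k : i != j ->
  (GLZ_transv c i j) l k = ((l == k)%:R + (k == i)%:R * (-1) ^+ c * (l ==
    j)%:R)%R.
Proof.
move=> ij; rewrite !mxE aut_transv_gen //; case: (eqVneq k i) => [->|ki];
  last first.
  by rewrite fg_ab_gen !mxE eqxx andbT mul0r mul0r addr0.
by case: c; rewrite fg_abM ?fg_abV !fg_ab_gen !mxE !eqxx !andbT ?expr1 ?expr0
  ?mulr1 mul1r ?mulN1r ?mul1r // addrC.
Qed.

Lemma col_step A i j : i != j ->
  (forall r k, (A * GLZ_transv false i j)%g r k = if k == i then A r i + A r j
    else A r k)%R /\
  (forall r k, (A * GLZ_transv true i j)%g r k = if k == i then A r i - A r j
    else A r k)%R.
Proof.
move=> ij.
have mulE c r k : (A * GLZ_transv c i j)%g r k = (A r k + (k == i)%:R * (-1) ^+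
  c * A r j)%R.
  rewrite mxE (eq_bigr (fun l => A r l * (l == k)%:R + (k == i)%:R * (-1) ^+ c *
    (A r l * (l == j)%:R))%R).
    rewrite big_split /= -mulr_sumr; congr (_ + _ * _)%R.
      by rewrite (bigD1 k) //= eqxx mulr1 big1 ?addr0 // => l /negPf->;
        rewrite mulr0.
    by rewrite (bigD1 j) //= eqxx mulr1 big1 ?addr0 // => l /negPf->;
      rewrite mulr0.
  by move=> l _; rewrite GLZ_transvE // mulrDr mulrCA.
split=> r k; rewrite mulE ?expr0 ?expr1 ?mulr1; case: (eqVneq k i) => [->|_].
- by rewrite mul1r.
- by rewrite mul0r addr0.
- by rewrite mul1r mulN1r.
by rewrite !mul0r addr0.
Qed.

Lemma col_add A i j (z : int) : i != j ->
  exists2 e, gen e & forall r k,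
    (A * e)%g r k = (if k == i then A r i + z * A r j else A r k)%R.
Proof.
move=> ij; have ji : (j == i) = false by rewrite eq_sym (negPf ij).
elim: z => [|m [e ge fe]|m [e ge fe]].
- exists 1; first exact: transv_gen1.
  by move=> r k; rewrite mulg1 mul0r addr0; case: eqVneq => [->|].
- exists (e * GLZ_transv false i j); first exact: transv_genM.
  move=> r k; rewrite mulgA (col_step _ ij).1 !fe eqxx ji.
  case: ifP => [_|->//]; rewrite -addrA; congr (_ + _)%R.
  by rewrite intS mulrDl mul1r addrC.
exists (e * GLZ_transv true i j); first exact: transv_genM.
move=> r k; rewrite mulgA (col_step _ ij).2 !fe eqxx ji.
case: ifP => [_|->//]; rewrite -addrA; congr (_ + _)%R.
by rewrite intS opprD mulrDl mulN1r addrC.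
Qed.

Lemma col_clear A k (z : 'I_n -> int) :
  exists2 e, gen e & forall r i,
    (A * e)%g r i = (if i == k then A r k else A r i + z i * A r k)%R.
Proof.
suff [e ge fe] : exists2 e, gen e & forall r i, (A * e)%g r i =
    (if (i == k) || (i \notin enum 'I_n) then A r i else A r i + z i * A r k)%R.
  by exists e => // r i; rewrite fe mem_enum orbF; case: eqVneq => [->|].
elim: (enum _) (enum_uniq 'I_n) => [_|m s IHs /=/andP[ms us]].
  by exists 1; [exact: transv_gen1 | move=> r i; rewrite orbT mulg1].
have [e ge fe] := IHs us; have [Emk|mk] := eqVneq m k.
  exists e => // r i; rewrite fe in_cons Emk negb_or.
  by case: (i == k).
have [e' ge' fe'] := col_add (A * e) (z m) mk.
exists (e * e'); first exact: transv_gen_mul.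
move=> r i; rewrite -[LHS]/((A * (e * e'))%g r i) mulgA fe' !fe in_cons negb_or
  eqxx.
by have [->|im] := eqVneq i m; rewrite ?ms ?(negPf mk) //= orbT.
Qed.

Definition unit_rows S A := forall r j, r \in S -> A r j = (r == j)%:R%R.

(** A row of [A] that is a unit row, multiplied by the inverse, shows that the entry of the inverse
    in column [k] vanishes at that index. So the entries of row [k] outside [S] alone are
    coprime. *)
Lemma unit_rows_sum S A k : unit_rows S A -> k \notin S ->
  (\sum_(j | j \notin S) A k j * (invmx A) j k = 1)%R.
Proof.
move=> AS kS; have AV r : (\sum_j A r j * (invmx A) j k = (r == k)%:R)%R.
  by have := congr1 (fun M : 'M[int]_n => M r k) (mulmxV (GL_mxP A));
    rewrite !mxE.
have := AV k; rewrite eqxx (bigID (mem S)) /= big1 ?add0r // => j jS.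
have := AV j; have -> : (j == k) = false by apply: contraNF kS => /eqP <-.
rewrite (bigD1 j) //= AS // eqxx mul1r big1 ?addr0 => [->|l lj];
  first by rewrite mulr0.
by rewrite AS // eq_sym (negPf lj) mul0r.
Qed.

(** The Euclidean algorithm in row [k]: an entry that divides all the others outside [S] divides 1
    by [unit_rows_sum], and otherwise a remainder is smaller. Columns outside [S] vanish on the rows
    of [S], so adding them is harmless. *)
Lemma unit_entry S A k : unit_rows S A -> k \notin S ->
  exists2 e, gen e & unit_rows S (A * e) /\ exists2 j, j \notin S & (`|(A * e)%g
    k j| = 1)%R.
Proof.
move=> + kS; suff main m B : unit_rows S B -> (exists2 j, j \notin S & 0 < absz
  (B k j) <= m)%N ->
    exists2 e, gen e & unit_rows S (B * e) /\ exists2 j, j \notin S & (`|(B *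
      e)%g k j| = 1)%R.
  move=> AS; have [/existsP[j /andP[jS Aj]]|no] := boolP [exists j, (j \notin S)
    && (A k j != 0)%R].
    by apply: (main (absz (A k j))) => //; exists j => //;
      rewrite absz_gt0 Aj leqnn.
  have := unit_rows_sum AS kS; rewrite big1 => [/eqP|j jS];
    first by rewrite eq_sym oner_eq0.
  have := no; rewrite negb_exists => /forallP/(_ j); rewrite jS negbK => /eqP->.
  by rewrite mul0r.
elim: m B => [B _ [j _]|m IHm B BS [j jS /andP[j0 jm]]].
  by rewrite leqn0 => /andP[/lt0n_neq0/negPf->].
have [/forallP all_dvd|] := boolP [forall i, (i \notin S) ==> (B k j %| B k
  i)%Z].
  exists 1; first exact: transv_gen1.
  rewrite mulg1; split=> //; exists j => //.
  have : (B k j %| 1%R)%Z.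
    rewrite -(unit_rows_sum BS kS); apply: rpred_sum => i iS.
    by apply: dvdz_mulr; have := all_dvd i; rewrite iS.
  by rewrite dvdz1 -abszE => /eqP->.
rewrite negb_forall => /existsP[i]; rewrite negb_imply => /andP[iS ndvd].
have ij : i != j by apply: contraNneq ndvd => ->; apply: dvdzz.
have [e ge fe] := col_add B (- (B k i %/ B k j)%Z)%R ij.
have BeS : unit_rows S (B * e).
  move=> r l rS; rewrite fe; case: ifP => [/eqP->|_]; last exact: BS.
  rewrite (BS _ i rS) (BS _ j rS) (_ : (r == j) = false) ?mulr0 ?addr0 //.
  by apply: contraNF jS => /eqP <-.
have kj0 : (B k j != 0)%R by rewrite -absz_gt0.
have [|e' ge' [Be'S [l lS El]]] := IHm (B * e) BeS.
  exists i => //; rewrite fe eqxx mulNr.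
  have -> : (B k i - (B k i %/ B k j)%Z * B k j = (B k i %% B k j)%Z)%R by [].
  have mod_ge0 := modz_ge0 (B k i) kj0.
  rewrite absz_gt0 -(rwP andP); split.
    by apply: contraNneq ndvd => E; apply/dvdz_mod0P.
  rewrite -ltnS (leq_trans _ jm) // -ltz_nat gez0_abs //.
  exact: ltz_mod.
exists (e * e'); first exact: transv_gen_mul.
by rewrite mulgA; split=> //; exists l.
Qed.

Lemma unit_rows_add S A B i j (z : int) : unit_rows S A -> j \notin S ->
    (forall r l, B r l = (if l == i then A r i + z * A r j else A r l)%R) ->
  unit_rows S B.
Proof.
move=> AS jS BE r l rS; rewrite BE; case: ifP => [/eqP->|_]; last exact: AS.
rewrite (AS _ i rS) (AS _ j rS) (_ : (r == j) = false) ?mulr0 ?addr0 //.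
by apply: contraNF jS => /eqP <-.
Qed.

Lemma sqr_unit (b : int) : (`|b| = 1 -> b * b = 1)%R.
Proof. by move=> b1; rewrite -expr2 -real_normK ?num_real // b1 expr1n. Qed.

(** The diagonal entry has to become 1 and not -1, so a unit is first placed in another column, for
    which [o] is the spare one. If [b] is 1 or -1, adding [b * (1 - a)] times a column with entry
    [b] turns an entry [a] into 1. *)
Lemma unit_rows_next S A k o : unit_rows S A -> k \notin S -> o \notin S -> k !=
  o ->
  exists2 e, gen e & unit_rows (k |: S) (A * e).
Proof.
move=> AS kS oS ko; have [e ge [BS [j jS Bj]]] := unit_entry AS kS.
have [e1 ge1 [B1S [j1 jk Bj1]]] : exists2 e1, gen e1 & unit_rows S (A * e1) /\
    exists2 j, j != k /\ j \notin S & (`|(A * e1)%g k j| = 1)%R.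
  have [Ejk|jk] := eqVneq j k; last by exists e => //; split=> //; exists j.
  subst j; pose z := ((A * e)%g k k * (1 - (A * e)%g k o))%R.
  have ok : o != k by rewrite eq_sym.
  have [e' ge' fe'] := col_add (A * e) z ok; exists (e * e');
    first exact: transv_gen_mul.
  rewrite mulgA; split; first exact: unit_rows_add BS kS fe'.
  exists o; rewrite // fe' eqxx /z mulrC mulrA sqr_unit // mul1r addrC subrK.
  by rewrite normr1.
have [jk1 j1S] := jk; have kj : k != j1 by rewrite eq_sym.
pose z := ((A * e1)%g k j1 * (1 - (A * e1)%g k k))%R.
have [e2 ge2 fe2] := col_add (A * e1) z kj.
have B2S := unit_rows_add B1S j1S fe2.
have B2k : ((A * e1 * e2)%g k k = 1)%R.
  by rewrite fe2 eqxx /z mulrC mulrA sqr_unit // mul1r addrC subrK.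
have [e3 ge3 fe3] := col_clear (A * e1 * e2) k (fun i =>
  - (A * e1 * e2)%g k i)%R.
exists (e1 * e2 * e3); first by do !apply: transv_gen_mul.
rewrite !mulgA => r l; rewrite fe3 !inE => /predU1P[->|rS].
  case: (eqVneq l k) => [_|lk]; first by rewrite B2k.
  by rewrite B2k mulr1 subrr.
have rk : (r == k) = false by apply: contraNF kS => /eqP <-.
case: eqVneq => [->|lk]; first by rewrite B2S.
by rewrite [X in (_ + _ * X)%R]B2S // rk mulr0 addr0 B2S.
Qed.

Lemma unit_rows_last A o : unit_rows (~: [set o]) A ->
  exists2 e, gen e & A * e = 1 \/ A * e = aut_GL (aut_flip o).
Proof.
move=> AS; have oS : o \notin ~: [set o] by rewrite !inE eqxx.
have Aoo : (`|A o o| = 1)%R.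
  have : (A o o %| 1%R)%Z.
    rewrite -(unit_rows_sum AS oS) (bigD1 o) //= big1 => [|i].
      by rewrite addr0 dvdz_mulr.
    by rewrite !inE negbK => /andP[->].
  by rewrite dvdz1 -abszE => /eqP->.
have [e ge fe] := col_clear A o (fun i => - (A o i * A o o))%R.
have fE r i : ((A * e)%g r i = if (i == o) && (r == o) then A o o else (r ==
  i)%:R)%R.
  rewrite fe; have [->|ro] := eqVneq r o.
    rewrite andbT; case: ifP => [//|io].
    by rewrite mulNr -mulrA sqr_unit // mulr1 subrr eq_sym io.
  have rS : r \in ~: [set o] by rewrite !inE.
  rewrite andbF !(AS r) // (negPf ro) mulr0 addr0.
  by case: eqVneq => // ->; rewrite (negPf ro).
exists e => //; have [A1|AN1] : (A o o = 1 \/ A o o = -1)%R.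
- by move/eqP: Aoo; rewrite eqr_norml => /andP[/orP[/eqP|/eqP]]; [left | right].
- left; apply/val_inj/matrixP => r i; rewrite fE A1 mxE.
  by have [->|] := eqVneq i o; rewrite //= ; case: eqVneq.
right; apply/val_inj/matrixP => r i; rewrite fE AN1 !mxE aut_flip_gen.
have [->|io] /= := eqVneq i o; last by rewrite fg_ab_gen !mxE eqxx andbT.
by rewrite fg_abV fg_ab_gen !mxE eqxx andbT; case: eqVneq.
Qed.

Theorem GLZ_reduce o A : exists2 e, gen e & A * e = 1 \/ A * e = aut_GL
  (aut_flip o).
Proof.
suff main m S B : o \notin S -> unit_rows S B -> #|~: S| <= m ->
    exists2 e, gen e & B * e = 1 \/ B * e = aut_GL (aut_flip o).
  by apply: (main _ set0 A) (leqnn _); rewrite ?inE // => r j; rewrite inE.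
elim: m S B => [|m IHm] S B oS BS.
  by rewrite leqn0 cards_eq0 => /eqP S0; have := in_set0 o; rewrite -S0 inE oS.
have [Eo _|[k]] := set_0Vmem (~: S :\ o).
  apply: unit_rows_last; suff <- : S = ~: [set o] by [].
  have So : o \in ~: S by rewrite inE.
  by rewrite -[S]setCK -(setD1K So) Eo setU0.
rewrite !inE => /andP[ko kS] leS.
have [e ge BeS] := unit_rows_next BS kS oS ko.
have [|||e' ge' fe'] := IHm (k |: S) (B * e).
- by rewrite !inE negb_or eq_sym ko.
- exact: BeS.
- rewrite -ltnS (leq_trans _ leS) // [X in _ < X](cardsD1 k) inE kS ltnS.
  by rewrite setCU setDE setIC.
by exists (e * e'); [exact: transv_gen_mul | rewrite mulgA].
Qed.

End IntegerMatrices.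

(** * The six groups *)

Section Morphisms.

Variables (I : finType) (G H : groupType) (f : G -> H).
Hypothesis fM : {morph f : x y / x * y}.
Implicit Types (X : bool -> I -> I -> G) (Y : bool -> I -> I -> H).

Lemma morph_one : f 1 = 1.
Proof. by apply: (mulgI (f 1)); rewrite -fM !mulg1. Qed.

Lemma morph_inv x : f x^-1 = (f x)^-1.
Proof. by apply: (mulgI (f x)); rewrite -fM !mulgV morph_one. Qed.

Lemma morph_conj x y : f (x ^ y) = f x ^ f y.
Proof. by rewrite /conjg !fM morph_inv. Qed.

Lemma transv_rel_morph X Y : (forall c i j, i != j -> Y c i j = f (X c i j)) ->
  transv_rel X -> transv_rel Y.
Proof.
move=> YX [r1 r2 r3 r4]; split.
- by move=> c i j k ij ik jk; rewrite !YX // -morph_conj r1 // fM morph_inv.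
- by move=> c i j k ij ik jk; rewrite !YX // -morph_conj r2 // fM.
- by move=> b c i j k l *; rewrite !YX // /commute -!fM r3.
by move=> i j k *; rewrite !YX // /commute -!fM r4.
Qed.

Lemma transv_rel_inj X Y : injective f ->
  (forall c i j, i != j -> f (X c i j) = Y c i j) -> transv_rel Y -> transv_rel
    X.
Proof.
move=> f_inj XY [r1 r2 r3 r4]; split.
- by move=> c i j k *; apply: f_inj; rewrite morph_conj fM morph_inv !XY // r1.
- by move=> c i j k *; apply: f_inj; rewrite morph_conj fM !XY // r2.
- by move=> b c i j k l *; apply: f_inj; rewrite !fM !XY // r3.
by move=> i j k *; apply: f_inj; rewrite !fM !XY // r4.
Qed.

Lemma transv_gen_morph X Y e : (forall c i j, i != j -> Y c i j = f (X c i j))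
  ->
  transv_gen X e -> transv_gen Y (f e).
Proof.
move=> YX; elim=> [|g c i j _ IHg ij|g c i j _ IHg ij];
  rewrite ?morph_one ?fM ?morph_inv -?YX //.
- exact: transv_gen1.
- exact: transv_genM.
exact: transv_genV.
Qed.

Lemma transv_gen_lift X Y e : (forall c i j, i != j -> f (X c i j) = Y c i j) ->
  transv_gen Y e -> exists2 e', transv_gen X e' & f e' = e.
Proof.
move=> XY; elim=> [|g c i j _ [e' ge' <-] ij|g c i j _ [e' ge' <-] ij].
- by exists 1; [exact: transv_gen1 | exact: morph_one].
- by exists (e' * X c i j); [exact: transv_genM | rewrite fM XY].
by exists (e' * (X c i j)^-1); [exact: transv_genV | rewrite fM morph_inv XY].
Qed.

End Morphisms.

Lemma det_flip n (o : 'I_n) : (\det (aut_GL (aut_flip o)) = -1)%R.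
Proof.
have E (i k : 'I_n) : ((aut_GL (aut_flip o)) i k =
    (diag_mx (\row_k (if k == o then -1 else 1) : 'rV[int]_n)) i k)%R.
  rewrite !mxE aut_flip_gen; case: (eqVneq k o) => [->|ko].
    by rewrite fg_abV fg_ab_gen !mxE eqxx andbT; case: (eqVneq i o) => _;
      rewrite ?eqxx ?oppr0.
  by rewrite fg_ab_gen !mxE eqxx andbT; case: (eqVneq i k) => [->|_];
    rewrite ?(negPf ko).
have -> : GL_mx (aut_GL (aut_flip o)) = (diag_mx (\row_k (if k == o then -1 else
  1)))%R.
  by apply/matrixP.
rewrite det_diag (bigD1 o) //= mxE eqxx big1 ?mulr1 // => i io.
by rewrite mxE (negPf io).
Qed.

Lemma GLZ_transv_rel n : transv_rel (@GLZ_transv n).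
Proof.
by apply: (transv_rel_morph (@aut_GLM n) _ (@aut_transv_rel n)).
Qed.

Lemma det_GL_mul n (A B : GL n int) : (\det (A * B)%g = \det A * \det B)%R.
Proof. exact: det_mulmx. Qed.

Lemma det_GL_neq0 n (A : GL n int) : (\det A != 0)%R.
Proof. by have := GL_mxP A; rewrite unitmxE; apply: contraTneq => ->;
  rewrite unitr0. Qed.

Lemma det_GL_conj n (A B : GL n int) : (\det (A ^ B)%g = \det A)%R.
Proof.
apply: (mulfI (det_GL_neq0 B)); rewrite -det_GL_mul /conjg mulKVg det_GL_mul.
by rewrite mulrC.
Qed.

(** A transvection of the same row is conjugate to its product with the inverse of this one, and the
    determinant is a class function. *)
Lemma det_transv n c (i j : 'I_n) : 2 < n -> i != j -> (\det (GLZ_transv c i j)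
  = 1)%R.
Proof.
move=> n_ge3 ij; have [r1 _ _ _] := GLZ_transv_rel n.
have [|k /andP[]] := @ex_third 'I_n _ i j; first by rewrite card_ord.
rewrite !(eq_sym k) => ik jk; have kj : k != j by rewrite eq_sym.
apply: (mulfI (det_GL_neq0 (GLZ_transv c i k))); rewrite mulr1.
rewrite -{1}(det_GL_conj _ (GLZ_transv false k j)) r1 //.
by rewrite -det_GL_mul mulgVK.
Qed.

(** All that the finite argument needs to know of the six groups. [e0] represents the coset missed
    by the transvections: it is 1 for the three special groups and a change of one sign for the
    others. *)
Definition transv_structure (k : group_kind) (n : nat)
    (X : bool -> 'I_n -> 'I_n -> group_of k n) (e0 : group_of k n) :=
  [/\ transv_rel X,
      forall c i j, i != j -> to_GLZ (X c i j) = GLZ_transv c i j,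
      forall g, exists2 e, transv_gen X e & g * e = 1 \/ g * e = e0
    & e0 = 1 \/ (\det (to_GLZ e0) = -1)%R].

Lemma det_transv_gen n (e : GL n int) : 2 < n -> transv_gen (@GLZ_transv n) e ->
  (\det e = 1)%R.
Proof.
move=> n_ge3; elim=> [|g c i j _ IHg ij|g c i j _ IHg ij]; first exact: det1.
  by rewrite det_GL_mul IHg det_transv // mulr1.
apply: (mulIf (det_GL_neq0 (GLZ_transv c i j))).
by rewrite -det_GL_mul mulgVK IHg det_transv // mulr1.
Qed.

Lemma transv_structure_ex (k : group_kind) (n : nat) : 2 < n ->
  exists X e0, @transv_structure k n X e0.
Proof.
move=> n_ge3; pose o : 'I_n := Ordinal (ltnW (ltnW n_ge3)).
have flip_det := det_flip o.
have autGL c (i j : 'I_n) : i != j -> GLZ_transv c i j = aut_GL (aut_transv c i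
  j) by [].
have gen_det (e : autg (free_group n)) : transv_gen (@aut_transv n) e -> (\det
  (aut_GL e) = 1)%R.
  by move/(transv_gen_morph (@aut_GLM n) autGL)/(det_transv_gen n_ge3).
have special (f : autg (free_group n)) : SAut_pred f ->
    exists2 e, transv_gen (@aut_transv n) e & f * e = 1.
  move=> Sf; have [e ge [fe|fe]] := nielsen o f; exists e => //.
  have := congr1 (fun a => \det (aut_GL a))%R fe; rewrite aut_GLM det_GL_mul
    (gen_det _ ge) flip_det.
  by move: Sf => /eqP ->.
case: k.
- exists (@aut_transv n), (aut_flip o); split=> //; first exact: aut_transv_rel.
    exact: nielsen.
  by right.
- pose X c i j : SAut n := insubd (1 : SAut n) (aut_transv c i j).
  have XE c i j : i != j -> SAut_aut (X c i j) = aut_transv c i j.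
    by move=> ij; apply: insubdK; rewrite unfold_in /SAut_pred /SL_pred gen_det
      //; apply: transv_gen_in.
  exists X, 1; split.
  + exact: (transv_rel_inj (f := @SAut_aut n) (fun _ _ =>
    erefl) val_inj XE (@aut_transv_rel n)).
  + by move=> c i j ij; rewrite /= XE.
  + move=> g; have [e ge fe] := special _ (SAutP g).
    have [e' ge' Ee] := transv_gen_lift (f := @SAut_aut n) (fun _ _ =>
      erefl) XE ge.
    by exists e' => //; left; apply: val_inj; rewrite /= Ee.
  by left.
- exists (fun c i j => to_outg (aut_transv c i j)), (to_outg (aut_flip o));
    split.
  + by apply: (transv_rel_morph (@to_outgM _) _ (@aut_transv_rel n)).
  + by move=> c i j ij; rewrite /= out_GLE.
  + move=> g; have [f <-] : exists f, to_outg f = g by eexists;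
    apply: to_outg_repr.
    have [e ge fe] := nielsen o f.
    exists (to_outg e); first by apply: (transv_gen_morph (@to_outgM _) _ ge).
    by rewrite -to_outgM; case: fe => ->; [left | right].
  by right; rewrite (_ : to_GLZ _ = aut_GL (aut_flip o)) //; apply: out_GLE.
- have XP c (i j : 'I_n) : i != j -> SOut_pred (to_outg (aut_transv c i j)).
    move=> ij; apply/asboolP; exists (aut_transv c i j) => //.
    by rewrite /SAut_pred /SL_pred gen_det //; apply: transv_gen_in.
  pose X c i j : SOut n := insubd (1 : SOut n) (to_outg (aut_transv c i j)).
  have XE c i j : i != j -> SOut_out (X c i j) = to_outg (aut_transv c i j).
    by move=> ij; apply: insubdK; apply: XP.
  have relO : transv_rel (fun c i j => to_outg (@aut_transv n c i j)).
    by apply: (transv_rel_morph (@to_outgM _) _ (@aut_transv_rel n)).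
  exists X, 1; split.
  + exact: (transv_rel_inj (f := @SOut_out n) (fun _ _ =>
    erefl) val_inj XE relO).
  + by move=> c i j ij; rewrite /= XE // out_GLE.
  + move=> g; have /asboolP[f Sf Ef] := SOutP g.
    have [e ge fe] := special _ Sf.
    have [e' ge' Ee] := transv_gen_lift (f := @SOut_out n) (fun _ _ => erefl) XE
      (transv_gen_morph (@to_outgM _) (fun _ _ _ _ => erefl) ge).
    by exists e' => //; left; apply: val_inj; rewrite /= Ee -Ef -to_outgM fe.
  by left.
- exists (@GLZ_transv n), (aut_GL (aut_flip o)); split=> //;
    first exact: GLZ_transv_rel.
    exact: GLZ_reduce.
  by right.
pose X c i j : SL n int := insubd (1 : SL n int) (GLZ_transv c i j).
have XE c i j : i != j -> SL_GL (X c i j) = GLZ_transv c i j.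
  by move=> ij; apply: insubdK; rewrite unfold_in /SL_pred det_transv.
exists X, 1; split.
+ exact: (transv_rel_inj (f := @SL_GL n int) (fun _ _ =>
    erefl) val_inj XE (@GLZ_transv_rel n)).
+ by move=> c i j ij; rewrite /= XE.
+ move=> g; have [e ge fe] := GLZ_reduce o g.
  have [e' ge' Ee] := transv_gen_lift (f := @SL_GL n int) (fun _ _ =>
    erefl) XE ge.
  exists e' => //; left; apply: val_inj; rewrite /= Ee; case: fe => // fe.
  have := congr1 (fun a : GL n int => \det a)%R fe;
    rewrite det_GL_mul (det_transv_gen n_ge3 ge) flip_det.
  by have /eqP -> := SL_GLP g.
by left.
Qed.

(** * Finite quotients *)

HB.instance Definition _ n := [Finite of GL n 'F_2 by <:].
HB.instance Definition _ n := [Finite of SL n 'F_2 by <:].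

Lemma sl2_cardE n : sl2_card n = (2 ^ 'C(n, 2) * \prod_(1 <= i < n.+1) (2 ^ i -
  1))%N.
Proof.
elim: n => [|n IHn]; first by rewrite big_geq.
rewrite big_nat_recr //= IHn binS bin1 expnD subn1 [RHS]mulnACA [LHS]mulnC.
by congr (_ * _)%N; apply: mulnC.
Qed.

(** The upper bound is enough: together with the lower bound for a small quotient it yields equality
    in [SL_card]. *)
Lemma card_SL_le n : 0 < n -> #|{: SL n 'F_2}| <= sl2_card n.
Proof.
case: n => // n _; have UA (s : SL n.+1 'F_2) : GL_mx s \is a GRing.unit.
  exact: GL_mxP.
pose h (s : SL n.+1 'F_2) : {'GL_n.+1['F_2]} := FinRing.unit 'M['F_2]_n.+1 (UA
  s).
have h_inj : injective h.
  by move=> s t /(congr1 val) /= st; do 2!apply: val_inj.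
rewrite sl2_cardE; have := leq_card h h_inj.
by rewrite -[X in _ <= X]cardsT card_GL // card_Fp.
Qed.

Section RowAction.

Variable n : nat.
Implicit Types (s t : SL n 'F_2) (S : {set 'I_n}).

(* Subsets of 'I_n encode row vectors over 'F_2, on which SL n 'F_2 acts by
   right multiplication. *)
Definition row_act s S : {set 'I_n} := [set i | (\sum_(j in S) s j i != 0)%R].

Lemma F2_neq0 (a : 'F_2) : ((a != 0)%R)%:R%R = a.
Proof. by case: a => [[|[|]]] //= i; apply/val_inj. Qed.

Lemma row_actM s t S : row_act (s * t) S = row_act t (row_act s S).
Proof.
apply/setP => i; rewrite !inE; congr (_ != 0)%R.
transitivity (\sum_j \sum_(k in S) s k j * t j i)%R.
  by rewrite exchange_big; apply: eq_bigr => k _; rewrite !mxE.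
rewrite [RHS]big_mkcond; apply: eq_bigr => j _; rewrite -mulr_suml inE.
by case: ifPn => [sj|]; [rewrite -[X in (X * _)%R]F2_neq0 sj mul1r | rewrite
  negbK => /eqP->; rewrite mul0r].
Qed.

Lemma row_act1 S : row_act 1 S = S.
Proof.
apply/setP => i; rewrite inE; have [iS|iS] := boolP (i \in S).
  rewrite (bigD1 i) //= big1 ?addr0 ?mxE ?eqxx // => j /andP[_ /negPf ji].
  by rewrite mxE ji.
rewrite big1 ?eqxx // => j jS; rewrite mxE; case: eqP => // ji.
by rewrite -ji jS in iS.
Qed.

Lemma row_act_neq0 s S : S != set0 -> row_act s S != set0.
Proof.
apply: contraNneq => s0; have := row_actM s s^-1 S;
  rewrite mulgV row_act1 s0 => ->.
by apply/eqP/setP => i; rewrite !inE big_set0 eqxx.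
Qed.

Lemma row_act_inj s t : (forall j, row_act s [set j] = row_act t [set j]) -> s =
  t.
Proof.
move=> st; do 2!apply: val_inj; apply/matrixP => j i /=.
have /setP/(_ i) := st j.
by rewrite !inE !big_set1 => E; rewrite -[LHS]F2_neq0 E F2_neq0.
Qed.

Lemma row_act_transv A c i j S : i != j -> A = GLZ_transv c i j ->
  row_act (mod2 A) S = dual_act i j S.
Proof.
move=> ij ->; apply/setP => m; rewrite in_dual_act inE.
have sumS l : (\sum_(a in S) (a == l)%:R = (l \in S)%:R :> 'F_2)%R.
  have [lS|lS] := boolP (l \in S).
    by rewrite (bigD1 l) //= eqxx big1 ?addr0 // => a /andP[_ /negPf->].
  by rewrite big1 // => a aS; case: eqP aS lS => // -> ->.
have N1 : (-1 = 1 :> 'F_2)%R by apply/val_inj.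
rewrite (eq_bigr (fun l => (l == m)%:R + (m == i)%:R * (l == j)%:R)%R) =>
  [|l _]; last first.
  by rewrite mxE GLZ_transvE // rmorphD !rmorphM rmorphXn rmorphN1 /=
    !rmorph_nat N1 expr1n mulr1.
rewrite big_split /= -mulr_sumr !sumS.
by case: (m \in S); case: (m == i); case: (j \in S);
  rewrite /= ?mulr1 ?mulr0 ?mul1r ?addr0 ?add0r.
Qed.

(** If the image of e_k under [s] involved another coordinate [l], the transvection adding [l] to
    [k] would fix e_k but move its image. *)
Lemma row_act_central s :
    (forall i j, i != j -> exists2 t, commute s t & forall S, row_act t S =
      dual_act i j S) ->
  s = 1.
Proof.
move=> sC; apply: row_act_inj => k; rewrite row_act1.
have sub : row_act s [set k] \subset [set k].
  apply/subsetP => l sl; rewrite inE; apply: contraT => lk.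
  have kl : k != l by rewrite eq_sym.
  have [t st tE] := sC k l kl.
  have : row_act s [set k] = dual_act k l (row_act s [set k]).
    by rewrite -tE -row_actM st row_actM tE /dual_act inE (negPf lk).
  move/setP/(_ k); rewrite in_dual_act eqxx sl /=.
  by case: (k \in _).
apply/eqP; rewrite eqEsubset sub sub1set.
have /set0Pn[l sl] : row_act s [set k] != set0.
  by apply: row_act_neq0; apply/set0Pn; exists k; rewrite inE.
by have lk := set1P (subsetP sub l sl); rewrite lk in sl.
Qed.

End RowAction.

Lemma transv_grpP (I : finType) (gT : finGroupType) (X : bool -> I -> I -> gT)
  z :
  z \in transv_grp X <-> transv_gen X z.
Proof.
split; last first.
  elim=> [|g c i j _ IHg ij|g c i j _ IHg ij]; first exact: group1.
    by rewrite groupM ?transv_in.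
  by rewrite groupM ?groupV ?transv_in.
have G0 : group_set [set z | `[< transv_gen X z >]].
  apply/group_setP; split=> [|a b]; rewrite !inE.
    by apply/asboolP/transv_gen1.
  by move=> /asboolP Xa /asboolP Xb; apply/asboolP/transv_gen_mul.
suff /subsetP sub : transv_group X \subset Group G0.
  by move=> /sub; rewrite inE => /asboolP.
by apply: transv_grp_sub => c i j ij; rewrite inE; apply/asboolP/transv_gen_in.
Qed.

Section FiniteQuotient.

Variables (n : nat) (k : group_kind) (gT : finGroupType) (p : group_of k n ->
  gT).
Hypotheses (n_ge3 : 2 < n) (pM : {morph p : x y / x * y}).
Hypothesis p_surj : forall z, exists g, p g = z.
Hypothesis p_nontriv : ~ exists h, forall z : gT, z = 1 \/ z = h.

Local Notation nat_map := (@natural_map k n).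
Let natM : {morph nat_map : x y / x * y} := @natural_mapM k n.

Variables (X : bool -> 'I_n -> 'I_n -> group_of k n) (e0 : group_of k n).
Hypothesis X_struct : transv_structure X e0.

Let Z c i j := p (X c i j).
Let W c i j := nat_map (X c i j).
Local Notation gen := (transv_gen X).

Let relX : transv_rel X. Proof. by case: X_struct. Qed.
Let XE c i j : i != j -> to_GLZ (X c i j) = GLZ_transv c i j.
Proof. by case: X_struct => _ + _ _; apply. Qed.
Let genX g : exists2 e, gen e & g * e = 1 \/ g * e = e0. Proof. by case:
  X_struct. Qed.
Let det_e0 : e0 = 1 \/ (\det (to_GLZ e0) = -1)%R. Proof. by case: X_struct. Qed.

Let relZ : transv_rel Z. Proof. by apply: (transv_rel_morph pM _ relX). Qed.
Let relW : transv_rel W. Proof. by apply: (transv_rel_morph natM _ relX). Qed.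

Let ordn_gt2 : 2 < #|'I_n|. Proof. by rewrite card_ord. Qed.

(** If the transvections died, only 1 and the image of [e0] would remain, and this is excluded by
    [p_nontriv]. *)
Let ntZ : exists c i j, i != j /\ Z c i j != 1.
Proof.
have [//|no] := pselect (exists c i j, i != j /\ Z c i j != 1); case: p_nontriv.
have Z1 c i j : i != j -> Z c i j = 1.
  by move=> ij; apply/eqP; apply: contraT => Zij; case: no; exists c, i, j.
have p1 e : gen e -> p e = 1.
  elim=> [|g c i j _ IHg ij|g c i j _ IHg ij]; first exact: morph_one.
    by rewrite pM IHg mul1g; apply: Z1.
  by rewrite pM IHg mul1g (morph_inv pM) -/(Z c i j) Z1 // invg1.
exists (p e0) => z; have [g <-] := p_surj z; have [e /p1 pe [ge|ge]] := genX g.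
  by left; rewrite -(mulg1 (p g)) -pe -pM ge (morph_one pM).
by right; rewrite -(mulg1 (p g)) -pe -pM ge.
Qed.

Let ntW : exists c i j, i != j /\ W c i j != 1.
Proof.
pose i : 'I_n := Ordinal (ltnW (ltnW n_ge3)); pose j : 'I_n := Ordinal (ltnW
  n_ge3).
exists false, i, j; split=> //; apply/eqP => Wij.
have := row_act_transv [set j] (isT : i != j) (XE false (isT : i != j)).
rewrite -/(nat_map _) -/(W false i j) Wij row_act1 => /setP/(_ i).
by rewrite in_dual_act !inE eqxx.
Qed.

Lemma quotient_bound : sl2_card n <= #|gT|.
Proof.
have [le _] := transv_bound relZ ordn_gt2 ntZ; rewrite card_ord in le.
exact: leq_trans le (max_card _).
Qed.

Hypothesis gT_small : #|gT| <= #|{: SL n 'F_2}|.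

Let n_gt0 : 0 < n. Proof. exact: ltnW (ltnW n_ge3). Qed.

Let SL_card : #|{: SL n 'F_2}| = sl2_card n.
Proof.
apply/eqP; rewrite eqn_leq card_SL_le //=.
exact: leq_trans quotient_bound gT_small.
Qed.

Let gT_card : #|gT| = sl2_card n.
Proof. by apply/eqP; rewrite eqn_leq quotient_bound -SL_card gT_small. Qed.

Let Zfull z : z \in transv_grp Z.
Proof.
have [le _] := transv_bound relZ ordn_gt2 ntZ; rewrite card_ord in le.
have /eqP -> : transv_grp Z == [set: gT] by rewrite eqEcard subsetT cardsT
  gT_card.
by rewrite inE.
Qed.

Let Wfull s : s \in transv_grp W.
Proof.
have [le _] := transv_bound relW ordn_gt2 ntW; rewrite card_ord in le.
have /eqP -> : transv_grp W == [set: SL n 'F_2] by rewrite eqEcard subsetT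
  cardsT SL_card.
by rewrite inE.
Qed.

Let liftZ z : exists2 e, gen e & p e = z.
Proof. exact: (transv_gen_lift pM (fun _ _ _ _ => erefl)) (iffLR (transv_grpP Z
  z) (Zfull z)). Qed.

Let liftW s : exists2 e, gen e & nat_map e = s.
Proof. exact: (transv_gen_lift natM (fun _ _ _ _ =>
  erefl)) (iffLR (transv_grpP W s) (Wfull s)). Qed.

Let nontrivZ c i j : i != j -> Z c i j != 1.
Proof.
have [c' [i' [j' [ij' nt]]]] := ntZ => ij; apply: contraNneq nt => E.
by apply/eqP/(transv_eq1 relZ ordn_gt2 ij E).
Qed.

Let eqZ i j : i != j -> Z true i j = Z false i j /\ Z false i j ^+ 2 = 1.
Proof.
have [_] := transv_bound relZ ordn_gt2 ntZ; rewrite card_ord; apply.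
rewrite -gT_card -cardsT; apply: eq_card => z.
by rewrite inE; apply: Zfull.
Qed.

Local Notation pt := (mod2_point Z).

Let pt_act e S : gen e -> S != set0 -> pt S :^ p e = pt (row_act (nat_map e) S).
Proof.
have one c i j S' : i != j -> S' != set0 ->
    pt S' :^ p (X c i j) = pt (row_act (nat_map (X c i j)) S').
  move=> ij S0; rewrite (row_act_transv _ ij (XE c ij)) -/(Z c i j).
  have -> : Z c i j = Z false i j by case: c; rewrite ?(eqZ ij).1.
  by apply: (mod2_point_act relZ ordn_gt2) => // a b /eqZ[].
move=> ge; elim: ge S => [|g c i j _ IHg ij|g c i j _ IHg ij] S.
- by rewrite (morph_one pM) (morph_one natM) row_act1 conjsg1.
- by move=> S0; rewrite pM natM row_actM conjsgM IHg // one ?row_act_neq0.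
move=> S0; rewrite pM natM row_actM conjsgM IHg // (morph_inv pM) (morph_inv
  natM).
set T := row_act (nat_map g) S; have T0 : T != set0 by apply: row_act_neq0.
set T' := row_act _ T; have T'0 : T' != set0 by apply: row_act_neq0.
have -> : pt T = pt T' :^ p (X c i j) by rewrite one // /T' -row_actM mulVg
  row_act1.
by rewrite conjsgK.
Qed.

(** A word with trivial image fixes all points, so by [pt_act] and the injectivity of the points its
    matrix modulo 2 fixes all unit row vectors. *)
Let gen_ker_nat e : gen e -> p e = 1 -> nat_map e = 1.
Proof.
move=> ge pe; apply: row_act_inj => j; rewrite row_act1.
have j0 : [set j] != set0 by apply/set0Pn; exists j; rewrite inE.
apply: (mod2_point_inj relZ ordn_gt2 _ _ _ _ j0).
- exact: nontrivZ.
- by move=> a b /eqZ[].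
- by move=> a b /eqZ[].
- exact: row_act_neq0.
by rewrite -pt_act // pe conjsg1.
Qed.

Let gen_eq_nat e e' : gen e -> gen e' -> p e = p e' -> nat_map e = nat_map e'.
Proof.
move=> ge ge' pE; have : nat_map (e * e'^-1) = 1.
  apply: gen_ker_nat; first exact/transv_gen_mul/transv_gen_inv.
  by rewrite pM (morph_inv pM) pE mulgV.
by rewrite natM (morph_inv natM) => /eqP; rewrite -eq_mulgV1 => /eqP.
Qed.

Let gen_ker_p e : gen e -> nat_map e = 1 -> p e = 1.
Proof.
have /choice[h hP] z : exists e, gen e /\ p e = z.
  by have [e' ge' pe'] := liftZ z; exists e'.
pose psi z := nat_map (h z).
have psiE e' : gen e' -> psi (p e') = nat_map e'.
  by move=> ge'; have [gh ph] := hP (p e'); apply: gen_eq_nat.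
(* [psi] is onto a set of the same finite size, hence injective; this turns the inclusion of kernels
   around. *)
have psi_inj : {in gT &, injective psi}.
  apply/image_injP; rewrite eqn_leq leq_image_card /= gT_card -SL_card.
  apply/subset_leq_card/subsetP => s _; have [e' ge' <-] := liftW s.
  by apply/imageP; exists (p e'); rewrite ?psiE.
move=> ge ne; apply: psi_inj => //; rewrite psiE // ne -(morph_one pM) psiE
  ?(morph_one natM) //.
exact: transv_gen1.
Qed.

Let det_gen e : gen e -> (\det (to_GLZ e) = 1)%R.
Proof.
move=> ge; apply: (det_transv_gen n_ge3).
by apply: (transv_gen_morph (@to_GLZM k n) _ ge) => c i j /XE.
Qed.

(** A word [e1] with the image of [e0] is corrected by [d] in the kernel of [p]. Conjugation by [d]
    preserves determinants, so it maps words to words with the same image under [p], hence under the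
    natural map. So the image of [d] centralises the transvections and is trivial. *)
Let e0_gen : exists e, [/\ gen e, p e0 = p e & nat_map e0 = nat_map e].
Proof.
case: det_e0 => [->|De0]; first by exists 1; split=> //; apply: transv_gen1.
have [e1 ge1 pe1] := liftZ (p e0); exists e1; split=> //.
pose d := e0 * e1^-1; have pd : p d = 1 by rewrite pM (morph_inv pM) pe1 mulgV.
suff : nat_map d = 1.
  by rewrite natM (morph_inv natM) => /eqP; rewrite -eq_mulgV1 => /eqP.
have comm_gen e : gen e -> nat_map e ^ nat_map d = nat_map e.
  move=> ge; have [e2 ge2 E] := genX (e ^ d).
  have ged : gen (e ^ d).
    case: E => E.
      have -> : e ^ d = e2^-1 by apply: (mulIg e2); rewrite E mulVg.
      exact: transv_gen_inv.
    have := congr1 (fun g => \det (to_GLZ g))%R E.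
    by rewrite to_GLZM (morph_conj (@to_GLZM k n)) det_GL_mul det_GL_conj
      (det_gen ge) (det_gen ge2) De0.
  rewrite -(morph_conj natM); apply: gen_eq_nat => //.
  by rewrite (morph_conj pM) pd conjg1.
apply: row_act_central => i j ij; exists (W false i j).
  by apply/commute_sym/commgP/conjg_fixP/comm_gen/transv_gen_in.
by move=> S; rewrite (row_act_transv S ij (XE false ij)).
Qed.

Let all_gen g : exists e, [/\ gen e, p g = p e & nat_map g = nat_map e].
Proof.
have [e ge E] := genX g.
have [a [ga pa na]] : exists a, [/\ gen a, p (g * e) = p a & nat_map (g * e) =
  nat_map a].
  case: E => ->; last exact: e0_gen.
  by exists 1; split=> //; apply: transv_gen1.
exists (a * e^-1); split; first exact/transv_gen_mul/transv_gen_inv.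
  by rewrite pM (morph_inv pM) -pa pM mulgK.
by rewrite natM (morph_inv natM) -na natM mulgK.
Qed.

Lemma quotient_ker g : p g = 1 <-> nat_map g = 1.
Proof.
have [e [ge -> ->]] := all_gen g.
by split; [apply: gen_ker_nat | apply: gen_ker_p].
Qed.

Lemma natural_map_surj s : exists g, nat_map g = s.
Proof. by have [e _ <-] := liftW s; exists e. Qed.

End FiniteQuotient.

(* From finite groups to arbitrary quotients *)
From mathcomp Require Import classical_sets functions cardinality.
From mathcomp Require Import all_boot all_order all_algebra.
Local Open Scope group_scope.

Lemma card_le_injective (A B : Type) (f : A -> B) : injective f ->
  ([set: A]%classic #<= [set: B]%classic)%card.
Proof.
move=> f_inj; have /injfunPex[g] : exists2 g : A -> B,
    set_fun [set: A]%classic [set: B]%classic g & set_inj [set: A]%classic g.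
  by exists f => // a b _ _; apply: f_inj.
exact: inj_card_le g.
Qed.

Lemma finite_group_copy (H : groupType) : finite_set [set: H]%classic ->
  exists (gT : finGroupType) (f : H -> gT), bijective f /\ {morph f : x y / x *
    y}.
Proof.
move/finite_seqP => [s sE]; have sP h : h \in s.
  by have : [set: H]%classic h by []; rewrite sE.
pose f h : seq_sub s := SeqSub (sP h).
have fK : cancel f val by [].
have Kf : cancel val f by move=> h; apply/val_inj.
pose mul (a b : seq_sub s) := f (val a * val b).
have mulA : associative mul by move=> a b c; apply/val_inj; rewrite /= mulgA.
have mul1 : left_id (f 1) mul by move=> a; apply/val_inj; rewrite /= mul1g.
have mulV : left_inverse (f 1) (fun a : seq_sub s => f (val a)^-1) mul.
  by move=> a; apply/val_inj; rewrite /= mulVg.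
pose B := Finite_isGroup.Build (seq_sub s) mulA mul1 mulV.
pose gT : finGroupType := HB.pack (seq_sub s) B.
exists gT, f; split; first by exists val.
by move=> a b; apply/val_inj.
Qed.

(** A base point allows a comparison of cardinals to be turned into a total injection into this
    group. *)
HB.instance Definition _ n := isPointed.Build (SL n 'F_2) 1.

Theorem theorem1 (n : nat) (n_ge3 : (3 <= n)%N) (k : group_kind)
    (H : groupType) (q : {multiplicative group_of k n -> H})
    (q_surj : forall h : H, exists g : group_of k n, q g = h)
    (H_noncyclic : ~ cyclic_group H) :
  (card_lt (SL n 'F_2) H \/ isomorphic_groups H (SL n 'F_2)) /\
  (isomorphic_groups H (SL n 'F_2) ->
     exists theta : {multiplicative SL n 'F_2 -> H},
       bijective theta /\ forall g : group_of k n, q g = theta (natural_map g)).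
Proof.
have qM : {morph q : x y / x * y} by move=> x y; rewrite gmulfM.
have finSL : finite_set [set: SL n 'F_2]%classic.
  by apply: finite_finset.
have [finH|infH] := pselect (finite_set [set: H]%classic); last first.
  split=> [|[f [g fK gK]]]; last first.
    by case: infH; apply: card_le_finite finSL; apply: card_le_injective
      (can_inj fK).
  left; split; last by move=> le; apply: infH; apply: card_le_finite finSL.
  (* An infinite [H] contains a copy of the natural numbers, into which the finite group embeds by
     its encoding. *)
  apply: (card_le_trans _ (iffLR (infiniteP _) infH)).
  exact: (card_le_injective (f := fun s : SL n 'F_2 =>
    pickle s)) (pcan_inj pickleK).
have [gT [f [[f' fK f'K] fM]]] := finite_group_copy finH.
pose p g := f (q g).
have pM : {morph p : x y / x * y} by move=> x y; rewrite /p qM fM.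
have p_surj z : exists g, p g = z.
  by have [g qg] := q_surj (f' z); exists g; rewrite /p qg f'K.
(* A group whose only elements are 1 and [h] is generated by [h]. *)
have p_nontriv : ~ exists h, forall z : gT, z = 1 \/ z = h.
  case=> h hP; apply: H_noncyclic; exists (f' h) => x.
  case: (hP (f x)) => E; [exists 0%N | exists 1%N]; left; apply: (can_inj fK).
    by rewrite E (morph_one fM).
  by rewrite E f'K.
have [X [e0 X_struct]] := transv_structure_ex k n_ge3.
have [small|big] := leqP #|gT| #|{: SL n 'F_2}|; last first.
  have no_inj (h : H -> SL n 'F_2) : injective h -> False.
    move=> h_inj; have := leq_card (h \o f') (inj_comp h_inj (can_inj f'K)).
    by rewrite leqNgt big.
  split=> [|[h [h' hK _]]]; last by case: (no_inj h (can_inj hK)).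
  left; split.
    pose w (s : SL n 'F_2) := f' (enum_val (widen_ord (ltnW big) (enum_rank
      s))).
    apply: (card_le_injective (f := w)) => s t /(can_inj f'K)/enum_val_inj E.
    by apply/enum_rank_inj/ord_inj; apply: (congr1 val E).
  case/pcard_injP => h h_inj; apply: (no_inj h) => x y.
  by apply: h_inj; rewrite classical_sets.in_setT.
have ker := quotient_ker n_ge3 pM p_surj p_nontriv X_struct small.
have surj := natural_map_surj n_ge3 pM p_surj p_nontriv X_struct small.
have quotE (G1 G2 : groupType) (h : G1 -> G2) x y :
    {morph h : x y / x * y} ->
    h x = h y <-> h (x * y^-1) = 1.
  move=> hM; rewrite hM (morph_inv hM); split=> [->|E]; first by rewrite mulgV.
  by apply: (mulIg (h y)^-1); rewrite E mulgV.
have qE g h : q g = q h <-> natural_map g = natural_map h.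
  rewrite (quotE _ _ _ _ _ (@natural_mapM k n)) -ker -(quotE _ _ _ _ _ pM) /p.
  by split=> [->|/(can_inj fK)].
(* Both maps are onto with the same fibres, so arbitrary sections [r] and [r'] induce mutually
   inverse morphisms that do not depend on the choice. *)
have /choice[r rE] s : exists g : group_of k n, natural_map g = s by apply:
  surj.
have /choice[r' r'E] h : exists g : group_of k n, q g = h by apply: q_surj.
have thetaM : {morph (fun s => q (r s)) : s t / s * t}.
  by move=> s t; rewrite -qM; apply/qE; rewrite natural_mapM !rE.
have theta'M : {morph (fun h => natural_map (r' h)) : s t / s * t}.
  by move=> s t; rewrite -natural_mapM; apply/qE; rewrite qM !r'E.
have thetaK : cancel (fun s => q (r s)) (fun h => natural_map (r' h)).
  by move=> s; rewrite -[RHS]rE; apply/qE; rewrite r'E.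
have theta'K : cancel (fun h => natural_map (r' h)) (fun s => q (r s)).
  by move=> h; rewrite -[RHS]r'E; apply/qE; rewrite rE.
split; last first.
  move=> _; pose m := isMultiplicative.Build _ _ (fun s => q (r s)) thetaM.
  pose theta : {multiplicative SL n 'F_2 -> H} := HB.pack (fun s => q (r s)) m.
  exists theta; split; first by exists (fun h => natural_map (r' h)).
  by move=> g; apply/qE; rewrite rE.
right; pose m := isMultiplicative.Build _ _ (fun h =>
  natural_map (r' h)) theta'M.
pose theta : {multiplicative H -> SL n 'F_2} := HB.pack (fun h =>
  natural_map (r' h)) m.
by exists theta; exists (fun s => q (r s)).
Qed.
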